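(* Let $n\ge 1$ and $d\ge 2$ be integers, and let $w=(w_{i,j_1\ldots j_d})_{1\le i,j_1,\ldots,j_d\le n}$ be a family of complex numbers that is completely symmetric in the indices $j_1,\ldots,j_d$. Let $F:\mathbb{C}^n\to\mathbb{C}^n$ be the polynomial map with components $$F_i(x)=x_i-\frac{1}{d!}\sum_{j_1,\ldots,j_d=1}^n w_{i,j_1\ldots j_d}\,x_{j_1}\cdots x_{j_d},\qquad 1\le i\le n.$$ Put $\|w\|_{\infty,1}=\max_{1\le i\le n}\sum_{j_1,\ldots,j_d=1}^n |w_{i,j_1\ldots j_d}|$, and for $y\in\mathbb{C}^n$ put $\|y\|_\infty=\max_{1\le i\le n}|y_i|$. Let $$R=\left(\frac{d!}{2^d\,\|w\|_{\infty,1}}\right)^{1/(d-1)}$$ (with $R=+\infty$ and $\|y\|_\infty/R=0$ if $w=0$). Then for every $y\in\mathbb{C}^n$ with $\|y\|_\infty<R$ and every $1\le i\le n$, the series $$G_i(y)=\sum_{V\ge 0}\sum_{N\ge 0}\frac{1}{V!\,N!}\sum_{\mathcal{T}}\mathcal{A}_i(\mathcal{T})$$ is absolutely convergent (as a sum over all triples $(V,N,\mathcal{T})$), where the inner sum is over all admissible trees $\mathcal{T}$ on $E(V,N)$ and $\mathcal{A}_i(\mathcal{T})$ is the amplitude of $\mathcal{T}$ (both defined in the context). Moreover, for every such $y$, the vector $G(y)=(G_1(y),\ldots,G_n(y))$ satisfies $$\|G(y)\|_\infty\le\frac{\|y\|_\infty}{1-\frac{\|y\|_\infty}{R}}$$ and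 $$F(G(y))=y.$$
   Context: Admissible trees. For each pair of integers $V,N\ge 0$, fix a finite set $E=E(V,N)$ which is a disjoint union $E=E_{\rm root}\cup E_{\rm internal}\cup E_{\rm leaf}$ with $|E_{\rm root}|=1$, $|E_{\rm internal}|=V$, $|E_{\rm leaf}|=N$. An admissible tree $\mathcal{T}$ on $E(V,N)$ is a (labeled) tree with vertex set $E$, viewed as its set of edges (unordered pairs of elements of $E$), such that every element of $E_{\rm root}\cup E_{\rm leaf}$ has valence (degree) $1$ and every element of $E_{\rm internal}$ has valence $d+1$. Such trees can exist only if $(d-1)V=N-1$; for all other pairs $(V,N)$ the sum over $\mathcal{T}$ is empty and equals $0$. Amplitude. Let $\mathcal{T}$ be an admissible tree on $E(V,N)$, $y\in\mathbb{C}^n$ and $1\le i\le n$. Direct all edges of $\mathcal{T}$ towards the root. Thus each leaf $a\in E_{\rm leaf}$ has a unique edge $l(a)$ leaving it, and each $b\in E_{\rm internal}$ has a unique edge $l_0(b)$ leaving it and $d$ edges $l_1(b),\ldots,l_d(b)$ coming into it (their order is irrelevant by the symmetry of $w$). To each edge $l\in\mathcal{T}$ assign an index $i_l\in\{1,\ldots,n\}$, and set $$A_i(\mathcal{T},(i_l)_{l\in\mathcal{T}})=\prod_{a\in E_{\rm leaf}}y_{i_{l(a)}}\ \prod_{b\in E_{\rm internal}}w_{i_{l_0(b)},\,i_{l_1(b)}\ldots i_{l_d(b)}}.$$ The amplitude $\mathcal{A}_i(\mathcal{T})$ is the sum of $A_i(\mathcal{T},(i_l)_{l\in\mathcal{T}})$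 over all index assignments $(i_l)_{l\in\mathcal{T}}\in\{1,\ldots,n\}^{\mathcal{T}}$ for which the edge arriving at the root has index equal to $i$. (For example, for $V=0$, $N=1$ the only tree is the single edge joining the leaf to the root, and its amplitude is $y_i$.) *)

(* Defs.v *)
From mathcomp Require Import all_boot all_order all_algebra perm.
From mathcomp Require Import complex.
From mathcomp Require Import all_classical all_reals all_analysis.

Set Implicit Arguments.
Unset Strict Implicit.
Unset Printing Implicit Defensive.

Import Order.TTheory GRing.Theory Num.Theory.
Import numFieldNormedType.Exports.

Local Open Scope classical_set_scope.
Local Open Scope ring_scope.

(* Complex numbers are R[i] for an arbitrary R : realType; Normc.normc is the
   modulus with values in R, unlike `|_|, which takes values in R[i]. *)

Section Graph.
Variable X : finType.
Implicit Type T : {set {set X}}.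

Definition adj T : rel X := [rel x y | [set x; y]%SET \in T].

(* ucycle allows the degenerate closed walks of length at most 2; genuine
   cycles of a simple graph have length at least 3. *)
Definition acyclic T : Prop :=
  forall c : seq X, (2 < size c)%N -> ~ ucycle (adj T) c.

Definition is_tree T : Prop :=
  [/\ forall e, e \in T -> #|e| = 2,
      forall x y, connect (adj T) x y
    & acyclic T].

Definition valence T (x : X) : nat := #|[set e in T | x \in e]%SET|.

End Graph.

(* The vertex set E(V, N): None is the root, Some (inl b) the internal
   vertices and Some (inr a) the leaves. *)
Definition vertex (V N : nat) : finType := option ('I_V + 'I_N)%type.

Section Trees.
Variables (d V N : nat).
Local Notation E := (vertex V N).
Implicit Type T : {set {set E}}.

Definition root : E := None.
Definition internal (b : 'I_V) : E := Some (inl b).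
Definition leaf (a : 'I_N) : E := Some (inr a).

Definition admissible T : Prop :=
  [/\ is_tree T,
      valence T root = 1%N,
      forall a : 'I_N, valence T (leaf a) = 1%N
    & forall b : 'I_V, valence T (internal b) = d.+1].

Definition admissible_trees : {set {set {set E}}} :=
  [set T | `[< admissible T >]]%SET.

(* The edge e, directed towards the root, points into its end which still
   reaches the root once e is deleted from the tree. *)
Definition root_side T (e : {set E}) (x : E) : bool :=
  connect (adj (T :\ e)%SET) x root.
Definition entering T (x : E) : {set {set E}} :=
  [set e in T | (x \in e) && root_side T e x]%SET.
Definition leaving T (x : E) : {set {set E}} :=
  [set e in T | (x \in e) && ~~ root_side T e x]%SET.

(* In an admissible tree, exactly one edge arrives at the root, exactly one
   edge leaves any other vertex and exactly d edges enter an internal vertex,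
   so that the default value set0 is never returned below. *)
Definition root_edge T : {set E} := nth finset.set0 (enum (entering T root)) 0.
Definition out_edge T (x : E) : {set E} := nth finset.set0 (enum (leaving T x)) 0.
Definition in_edge T (x : E) (k : 'I_d) : {set E} :=
  nth finset.set0 (enum (entering T x)) k.

End Trees.

Section Amplitude.
Variables (R : realType) (n d : nat).
Local Notation C := R[i].
(* w i j stands for w_{i, j_1 ... j_d}. *)
Variable w : 'I_n -> {ffun 'I_d -> 'I_n} -> C.
Variable y : 'I_n -> C.
Variable i : 'I_n.

Definition edge_of V N (T : {set {set vertex V N}}) : finType :=
  {e : {set vertex V N} | e \in T}.

(* The index i_e of an edge e of T; the default i is only returned for e
   outside T, which does not occur for admissible trees. *)
Definition edge_index V N (T : {set {set vertex V N}})
    (f : {ffun edge_of T -> 'I_n}) (e : {set vertex V N}) : 'I_n :=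
  if insub e is Some e' then f e' else i.

Definition indexed_amplitude V N (T : {set {set vertex V N}})
    (f : {ffun edge_of T -> 'I_n}) : C :=
  (\prod_(a < N) y (edge_index f (out_edge T (leaf V a)))) *
  (\prod_(b < V) w (edge_index f (out_edge T (internal N b)))
     [ffun k : 'I_d => edge_index f (in_edge T (internal N b) k)]).

Definition amplitude V N (T : {set {set vertex V N}}) : C :=
  \sum_(f : {ffun edge_of T -> 'I_n} | edge_index f (root_edge T) == i)
    indexed_amplitude f.

End Amplitude.

Definition tree_index (d : nat) : Type :=
  {VN : nat * nat & {T : {set {set vertex VN.1 VN.2}} |
                      T \in admissible_trees d VN.1 VN.2}}.

Section Series.
Variables (R : realType) (n d : nat).
Local Notation C := R[i].
Variable w : 'I_n -> {ffun 'I_d -> 'I_n} -> C.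

Definition tree_term (y : 'I_n -> C) (i : 'I_n) (t : tree_index d) : C :=
  amplitude w y i (val (tagged t)) / ((tag t).1`! * (tag t).2`!)%:R.

Definition absolutely_convergent (y : 'I_n -> C) (i : 'I_n) : Prop :=
  (\esum_(t in [set: tree_index d]) (Normc.normc (tree_term y i t))%:E
     < +oo)%E.

(* C^o carries the usual topology of the complex plane. *)
Definition tree_series (y : 'I_n -> C) (i : 'I_n) : C :=
  limn (series (fun V => limn (series (fun N =>
    (V`! * N`!)%:R^-1 *
      \sum_(T in admissible_trees d V N) amplitude w y i T : C^o)))).

Definition poly_map (x : 'I_n -> C) (i : 'I_n) : C :=
  x i - d`!%:R^-1 *
    \sum_(j : {ffun 'I_d -> 'I_n}) w i j * \prod_(k < d) x (j k).

Definition symmetric_family : Prop :=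
  forall (i : 'I_n) (s : 'S_d) (j : {ffun 'I_d -> 'I_n}),
    w i [ffun k => j (s k)] = w i j.

Definition sup_norm (y : 'I_n -> C) : R :=
  \big[Num.max/0]_(i < n) Normc.normc (y i).

Definition norm_inf1 : R :=
  \big[Num.max/0]_(i < n)
    \sum_(j : {ffun 'I_d -> 'I_n}) Normc.normc (w i j).

Definition inversion_radius : \bar R :=
  if [forall i, forall j, w i j == 0] then +oo%E
  else ((d`!%:R / (2 ^+ d * norm_inf1)) `^ (d.-1%:R^-1))%:E.

End Series.

(* Main.v *)
Require Import Defs.
From mathcomp Require Import all_boot all_order all_algebra perm.
From mathcomp Require Import complex.
From mathcomp Require Import all_classical all_reals all_analysis.
From mathcomp Require Import ring lra zify.
Import Order.TTheory GRing.Theory Num.Theory.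
Import numFieldNormedType.Exports.
Local Open Scope ring_scope.

Set Implicit Arguments.
Unset Strict Implicit.
Unset Printing Implicit Defensive.

(* Rooting an admissible tree turns it into a parent function, and ordering the
   d children of every internal vertex turns it into a plane tree whose
   vertices are labelled; each tree has d!^V orderings.  A labelled plane tree
   is determined by its preorder traversal, in which the vertices are popped
   one by one from a stack, so that the sum of all amplitudes obeys a recursion
   removing one label at a time.  The same recursion is satisfied by the
   coefficients of products of the polynomials Q_m defined by Q_0 = 0 and
     Q_(m+1),i = y_i + X / d! * sum_j w_(i,j) prod_k Q_(m, j_k),
   which enumerate the plane trees of height at most m by their number V of
   internal vertices.  Hence the tree sum with V internal vertices, divided by
   V! N!, is the coefficient of X^V in Q_(m, i) for every m > V; it is bounded
   by |y| q^V with q = (|y| / R)^(d-1), because there are at most 2^(dV) preorder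
   words.  As Q_m(1) then converges to G, the recursion for Q_m at X = 1 becomes
   F(G) = y in the limit.  Absolute convergence follows from the same bound for
   the family |w| at |y|. *)

(** * Parent functions of trees *)

Section GraphTheory.
Variable X : finType.
Implicit Type T : {set {set X}}.

Lemma adj_sym T : symmetric (adj T).
Proof. by move=> x y; rewrite /adj /= finset.setUC. Qed.

Lemma connect_adj_sym T : connect_sym (adj T).
Proof. exact/sym_connect_sym/adj_sym. Qed.

(** A simple path from [x] to [z] avoiding the edge has at least two steps, since a single step
    would be the deleted edge itself; together with that edge it closes up to a genuine cycle. *)
Lemma acyclic_bridge T (x z : X) : acyclic T -> x != z ->
  [set x; z]%SET \in T -> ~~ connect (adj (T :\ [set x; z])%SET) x z.
Proof.
move=> acT xz eT; apply/negP => /connectP[p pp].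
case: (shortenP pp) => p' pp' up' _ zE.
have sub : subrel (adj (T :\ [set x; z])%SET) (adj T).
  by move=> a b; rewrite /adj /= in_setD1 => /andP[].
case: p' pp' up' zE => [|u [|v p']] pp' up' zE.
- by move: xz; rewrite [z]zE eqxx.
- by move: pp'; rewrite /= (_ : u = z) // andbT /adj /= in_setD1 eqxx.
- apply: (acT (x :: u :: v :: p')) => //; apply/andP; split=> //.
  rewrite (cycle_path x) /=; move/(sub_path sub): pp'; rewrite /= -/(path _ _ _).
  move=> ->; rewrite andbT.
  have -> : last v p' = z by rewrite zE.
  by rewrite adj_sym.
Qed.

(** Follow the path from [u] to [x] until it first uses the deleted edge: it is then at one of the
    two ends. *)
Lemma connect_ends T (x z u : X) : connect (adj T) u x ->
  connect (adj (T :\ [set x; z])%SET) u x ||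
  connect (adj (T :\ [set x; z])%SET) u z.
Proof.
case/connectP=> p; elim: p u => [|v p IH] u /=.
  by move=> _ <-; rewrite connect0.
case/andP=> uv pp xE; case: (eqVneq [set u; v]%SET [set x; z]%SET) => [E|ne].
  have : u \in [set x; z]%SET by rewrite -E !inE eqxx.
  by rewrite !inE => /orP[]/eqP->; rewrite connect0 ?orbT.
have uv' : connect (adj (T :\ [set x; z])%SET) u v.
  by apply: connect1; rewrite /adj /= in_setD1 ne.
by case/orP: (IH v pp xE) => /(connect_trans uv') ->; rewrite ?orbT.
Qed.

End GraphTheory.

Section Parents.
Variables V N : nat.
Local Notation X := ('I_V + 'I_N)%type.
Local Notation E := (vertex V N).
Local Notation root := (Defs.root V N).
Implicit Type T : {set {set E}}.

Lemma edge_ends T (e : {set E}) (x : E) : is_tree T -> e \in T -> x \in e ->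
  exists2 z, z != x & e = [set z; x]%SET.
Proof.
case=> card2 _ _ /card2/eqP/cards2P[a [b [ab ->]]].
rewrite !inE => /orP[]/eqP->; [exists b; rewrite 1?eq_sym 1?finset.setUC //|by exists a].
Qed.

Lemma root_side_excl T (u v : E) : is_tree T -> [set u; v]%SET \in T ->
  u != v -> root_side T [set u; v]%SET v = ~~ root_side T [set u; v]%SET u.
Proof.
case=> _ con acy eT uv; rewrite /root_side.
have := connect_ends v (con root u).
have := acyclic_bridge acy uv eT.
rewrite !(connect_adj_sym _ root).
set C := connect _ => nuv.
have [Cu|_] /= := boolP (C u root); last by move->.
move=> _; apply: contraNF nuv => Cv; apply: connect_trans Cu _.
by rewrite /C connect_adj_sym.
Qed.

(** Existence: the first edge [{x, p}] of a simple path from [x] to the root leaves [x]. Uniqueness: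
    this path survives the deletion of any other edge [e] at [x], so [x] lies on the root side of
    [e], which therefore enters [x]. *)
Lemma leavingP T (x : X) : is_tree T ->
  exists2 p : E, p != Some x & leaving T (Some x) = [set [set p; Some x]]%SET.
Proof.
move=> tT; have [_ con _] := tT.
have [p px [eT rp]] : exists2 z, z != Some x & [set z; Some x]%SET \in T /\
    root_side T [set z; Some x]%SET z.
  case/connectP: (con (Some x) root) => q pq.
  case: (shortenP pq) => q' pq' uq' _; case: q' pq' uq' => [|z q'] //=.
  rewrite in_cons negb_or; case/andP=> xz pz /andP[/andP[xnz xq] _] zE.
  exists z; first by rewrite eq_sym.
  rewrite finset.setUC; split=> //; apply/connectP; exists q' => //.
  have {}xq : Some x \notin z :: q' by rewrite in_cons negb_or xnz.
  set e := [set _; _]%SET; have xe : Some x \in e by rewrite !inE eqxx.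
  move: e xe => e xe; elim: q' z {zE xz xnz} pz xq => //= v q' IH z /andP[zv pv].
  rewrite in_cons negb_or => /andP[xz xv]; rewrite IH // andbT.
  rewrite /adj /= in_setD1 [X in _ && X]zv andbT.
  apply/eqP => /setP/(_ (Some x)); rewrite xe !inE (negPf xz) /=.
  by move: xv; rewrite in_cons negb_or => /andP[/negPf->].
exists p => //; apply/setP => e; rewrite !inE; apply/idP/eqP => [|->]; last first.
  by rewrite eT !inE eqxx orbT /= root_side_excl // rp.
case/and3P=> e'T xe nrs; apply/eqP; apply: contraT => ne.
have [z zx eE] := edge_ends tT e'T xe.
(* A walk from p to the root in T minus {p, x} never meets x. *)
have nx : ~~ root_side T [set p; Some x]%SET (Some x).
  by rewrite root_side_excl // rp.
case/negP: nrs; case/connectP: rp => q pq qE.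
have sub v q' : path (adj (T :\ [set p; Some x])%SET) v q' -> root = last v q' ->
    connect (adj (T :\ e)%SET) v root.
  elim: q' v => [|u q' IH] v /=; first by move=> _ ->.
  case/andP=> vu pu rE; apply: connect_trans (IH u pu rE); apply: connect1.
  have xvu : Some x \notin [set v; u]%SET.
    rewrite !inE negb_or; apply/andP; split; apply: contraNneq nx => E;
      rewrite [X in root_side _ _ X]E; apply/connectP.
      by exists (u :: q') => //; apply/andP.
    by exists q'.
  move: vu; rewrite /adj /= !in_setD1 => /andP[_ ->]; rewrite andbT.
  by apply: contraNneq xvu => ->.
apply: connect_trans (sub p q pq qE); apply: connect1.
by rewrite /adj /= in_setD1 [in X in X && _]finset.setUC [in X in _ && X]finset.setUC eT andbT eq_sym.
Qed.

Lemma leaving_root T : leaving T root = finset.set0.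
Proof. by apply/setP=> e; rewrite !inE /root_side connect0 !andbF. Qed.

Lemma valence_split T (x : E) :
  valence T x = (#|entering T x| + #|leaving T x|)%N.
Proof.
rewrite /valence -cardsUI [X in (_ + X)%N](_ : _ = 0)%N; last first.
  apply/eqP; rewrite cards_eq0; apply/eqP/setP => e; rewrite !inE.
  by do 2!case: (_ \in _) => //=; case: root_side.
rewrite addn0; apply: eq_card => e; rewrite !inE.
by do 2!case: (_ \in _) => //=; case: root_side.
Qed.

Definition is_parent T (p : X -> E) : Prop :=
  [/\ forall x, p x != Some x,
      forall x, leaving T (Some x) = [set [set p x; Some x]]%SET,
      forall u, entering T u = [set [set u; Some x] | x : X & p x == u]%SET
    & T = [set [set p x; Some x] | x : X]%SET].

Lemma set2_injr (T : finType) (a b c : T) : a != c -> b != c ->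
  [set a; c]%SET = [set b; c]%SET -> a = b.
Proof.
move=> ac bc /setP/(_ a); rewrite !inE eqxx (negPf ac) /= orbF.
by move/esym/eqP.
Qed.

Lemma set2_injl (T : finType) (a b c : T) : a != c -> b != c ->
  [set c; a]%SET = [set c; b]%SET -> a = b.
Proof.
by move=> ac bc; rewrite finset.setUC [RHS]finset.setUC; apply: set2_injr.
Qed.

(** [p x] is the far end of the unique edge leaving [x]. Every edge leaves exactly one of its ends,
    which is never the root; hence an edge entering [u] is the parent edge of its other end. *)
Lemma tree_parent T : is_tree T -> exists p, is_parent T p.
Proof.
move=> tT; have [p px pl] : exists2 p : X -> E, forall x, p x != Some x &
    forall x, leaving T (Some x) = [set [set p x; Some x]]%SET.
  have /fin_all_exists[p pP] : forall x : X, exists p : E, p != Some x /\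
      leaving T (Some x) = [set [set p; Some x]]%SET.
    by move=> x; have [p ? ?] := leavingP x tT; exists p.
  by exists p => x; have [] := pP x.
have eT x : [set p x; Some x]%SET \in T.
  have : [set p x; Some x]%SET \in leaving T (Some x) by rewrite pl inE.
  by rewrite inE => /andP[].
have rp x : root_side T [set p x; Some x]%SET (p x).
  have : [set p x; Some x]%SET \in leaving T (Some x) by rewrite pl inE.
  by rewrite inE root_side_excl // negbK => /and3P[].
have enP u : entering T u = [set [set u; Some x] | x : X & p x == u]%SET.
  apply/setP => e; apply/idP/imsetP => [|[x]]; last first.
    by rewrite inE => /eqP <- ->; rewrite inE eT rp !inE eqxx.
  rewrite inE => /and3P[e'T ue rs].
  have [z zu eE] := edge_ends tT e'T ue.
  have := rs; rewrite {1}eE root_side_excl -?eE // => nrz.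
  case: z eE nrz zu => [x|] eE nrz zu; last by rewrite /root_side connect0 in nrz.
  exists x; last by rewrite finset.setUC.
  have : e \in leaving T (Some x) by rewrite inE e'T nrz eE !inE eqxx.
  rewrite pl inE eE finset.setUC inE => /eqP/set2_injr -> //.
  by rewrite eq_sym.
exists p; split=> //; apply/setP => e; apply/idP/imsetP => [e'T|[x _ ->] //].
have [c2 _ _] := tT; move/eqP/cards2P: (c2 e e'T) => [a [b [ab eE]]].
have xr u : ~~ root_side T e u -> u \in e -> exists2 x : X, true & e = [set p x; Some x]%SET.
  case: u => [x|] nr xe; last by rewrite /root_side connect0 in nr.
  have : e \in leaving T (Some x) by rewrite inE e'T nr xe.
  by rewrite pl inE => /eqP->; exists x.
have [rb|/xr] := boolP (root_side T e b); last by apply; rewrite eE !inE eqxx orbT.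
apply: (xr a); last by rewrite eE !inE eqxx.
by move: rb; rewrite eE root_side_excl -?eE.
Qed.

Lemma parent_inj T p p' : is_parent T p -> is_parent T p' -> p =1 p'.
Proof.
move=> [px pl _ _] [p'x pl' _ _] x.
by have := pl x; rewrite pl' => /set1_inj/set2_injr ->.
Qed.

Definition parent_tree (p : X -> E) : {set {set E}} :=
  [set [set p x; Some x] | x : X]%SET.

(** Converse of [tree_parent]. Ranks decrease along [p], so iterating [p] reaches the root, and on a
    cycle both neighbours of a vertex of maximal rank would have to be its parent. *)
Lemma rank_tree (p : X -> E) (rho : E -> nat) :
  (forall x, rho (p x) < rho (Some x))%N ->
  is_tree (parent_tree p) /\ is_parent (parent_tree p) p.
Proof.
move=> rk; set T := parent_tree p.
have px x : p x != Some x by apply: contraTneq (rk x) => ->; rewrite ltnn.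
have eT x : [set p x; Some x]%SET \in T by apply: imset_f.

(* Climbing from rank at most [m] uses only parent edges of vertices of rank at most [m]. Taking the
   empty set for [e] gives connectedness; taking the parent edge of [x] and [m = rho (p x)] shows
   that this edge enters [p x]. *)
have climb (e : {set E}) m : (forall x, rho (Some x) <= m -> [set p x; Some x]%SET != e)%N ->
    forall v, (rho v <= m)%N -> connect (adj (T :\ e)%SET) v root.
  move=> he v; elim: {v}(rho v).+1 {-2}v (ltnSn (rho v)) => // k IH [x|] //.
  move=> xk xm; apply: (@connect_trans _ _ (p x)).
    by apply: connect1; rewrite /adj /= in_setD1 finset.setUC eT he.
  apply: IH; first exact: leq_trans (rk x) _.
  exact: leq_trans (ltnW (rk x)) xm.
have tT : is_tree T.
  split.
  - by move=> e /imsetP[x _ ->]; rewrite cards2 px.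
  - have cr v : connect (adj T) v root.
      have -> : T = (T :\ finset.set0)%SET.
        apply/setP=> e; rewrite in_setD1 andbC; case: imsetP => //= -[x _ ->].
        by apply/esym/set0Pn; exists (Some x); rewrite !inE eqxx orbT.
      apply: (climb _ (rho v)) => // x _.
      by apply/set0Pn; exists (Some x); rewrite !inE eqxx orbT.
    by move=> x y; apply: connect_trans (cr x) _; rewrite connect_adj_sym.
  - move=> c c3 /andP[cc uc].
    have [x0 x0c] : exists x, x \in c by case: c c3 {cc uc} => // x c; exists x; rewrite mem_head.
    pose x := [arg max_(x > x0 | x \in c) rho x].
    have [xc xmax] : x \in c /\ forall z, z \in c -> (rho z <= rho x)%N.
      by rewrite /x; case: arg_maxnP.
    have down z : z \in c -> adj T x z -> exists2 u, x = Some u & z = p u.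
      move=> zc /imsetP[u _ xzE].
      have xz : x != z.
        by apply/eqP => E0; move: (cards2 (p u) (Some u)); rewrite -xzE px E0 finset.setUid cards1.
      have : x \in [set p u; Some u]%SET by rewrite -xzE !inE eqxx.
      have : z \in [set p u; Some u]%SET by rewrite -xzE !inE eqxx orbT.
      rewrite !inE => /orP[]/eqP zE /orP[]/eqP xE; first by rewrite xE zE eqxx in xz.
      + by exists u.
      + by have := xmax z zc; rewrite zE xE leqNgt rk.
      + by rewrite xE zE eqxx in xz.
    have [k c' cE] := rot_to xc.
    have := c3; rewrite -(size_rot k) cE; move: cc; rewrite -(rot_cycle k) cE.
    move: uc; rewrite -(rot_uniq k) cE.
    have sc z : z \in c' -> z \in c.
      by move=> zc'; rewrite -(mem_rot k) cE in_cons zc' orbT.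
    (* With the cycle rotated to start at [x], its neighbours are [z1] and the last vertex, distinct
       because the length exceeds 2. *)
    case: c' sc {cE} => [|z1 [|z2 c']] sc //= /and3P[_ z1n _] /and3P[a1 _].
    rewrite -cats1 cat_path /= => /and3P[_ aL _] _.
    have [|u xu z1E] := down z1 _ a1; first by rewrite sc ?mem_head.
    have lc : last z2 c' \in z2 :: c' by apply: mem_last.
    have [||u' xu' zE] := down (last z2 c'); first by rewrite sc // in_cons lc orbT.
      by rewrite adj_sym.
    move: xu'; rewrite xu => -[uu]; move: z1n; rewrite z1E uu -zE lc.
    done.
split=> //; have [p' pp'] := tree_parent tT.
suff -> : p = p' by [].
apply/funext => x; have [p'x _ en' _] := pp'.
have : [set p x; Some x]%SET \in entering T (p x).
  rewrite inE eT !inE eqxx /=; apply: (climb _ (rho (p x))) => // z zx.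
  apply/eqP => /setP/(_ (Some x)); rewrite !inE eqxx orbT => /orP[]/eqP E.
    by move: (rk x); rewrite E ltnNge (leq_trans (ltnW (rk z)) zx).
  by move: (rk x); rewrite E ltnNge zx.
rewrite en' => /imsetP[z]; rewrite inE => /eqP zE E.
suff xz : x = z by rewrite -zE xz.
move/setP/(_ (Some x)): E; rewrite !inE eqxx orbT => /esym/orP[]/eqP; last by case.
by move=> E; have := px x; rewrite -E eqxx.
Qed.

End Parents.

(** * Orderings and preorder traversals *)

Section Traversal.
Variables (X : finType) (ch : X -> seq X).
Implicit Types (Q : {set X}) (s : seq X).

(* s is the stack of the vertices still to be explored and Q the set of the
   unvisited ones: the traversal succeeds when it visits all of Q, each vertex
   once, in exactly m steps. *)
Fixpoint traversal m Q s : bool :=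
  match m, s with
  | 0, [::] => true
  | m'.+1, x :: s' =>
      (x \in Q) && traversal m' (Q :\ x)%SET (ch x ++ s')
  | _, _ => false
  end.

(** These clauses describe an ordered forest with vertex set [Q] and list of roots [s], except that
    a cycle of descendants away from [s] is still allowed. Excluding it takes a rank function or the
    extra hypothesis of [inv_traversal]. *)
Record forest_inv Q s : Prop := ForestInv {
  fi_uniq : uniq s;
  fi_sub : {subset s <= Q};
  fi_child : forall x y, x \in Q -> y \in ch x -> (y \in Q) && (y \notin s);
  fi_cover : forall y, y \in Q -> y \notin s -> exists2 x, x \in Q & y \in ch x;
  fi_uniq_ch : forall x, x \in Q -> uniq (ch x);
  fi_inj : forall x x' y, x \in Q -> x' \in Q -> y \in ch x -> y \in ch x' -> x = x'
}.

(** Undo one step of the traversal: the roots [ch x] are grafted onto the new root [x]. The rank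
    puts [x] at 0 and shifts all other vertices up by one. *)
Lemma traversal_inv m Q s : #|Q| = m -> traversal m Q s ->
  forest_inv Q s /\
  exists rho : X -> nat, forall x y, x \in Q -> y \in ch x -> (rho x < rho y)%N.
Proof.
elim: m Q s => [|m IH] Q [|x s] //= Qm.
  move=> _; have -> : Q = finset.set0 by apply/eqP; rewrite -cards_eq0 Qm.
  split; last by exists (fun=> 0%N) => x y; rewrite inE.
  by split=> // x; rewrite !inE.
case/andP=> xQ; have {}Qm : #|(Q :\ x)%SET| = m.
  by move: Qm; rewrite (cardsD1 x) xQ => -[].
case/(IH _ _ Qm) => -[us ss cs vs uc ic] [rho rk].
have sQ y : y \in s -> (y != x) && (y \in Q).
  by move=> ys; rewrite -in_setD1; apply: ss; rewrite mem_cat ys orbT.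
have cQ y : y \in ch x -> [/\ y != x, y \in Q & y \notin s].
  move=> yx; have := ss y; rewrite mem_cat yx in_setD1 => /(_ isT)/andP[-> ->].
  split=> //; move: us; rewrite cat_uniq => /and3P[_ /hasPn h _].
  by apply/negP => /h; rewrite /= yx.
have cQ' z y : z \in Q -> z != x -> y \in ch z ->
    [/\ y != x, y \in Q, y \notin s & y \notin ch x].
  move=> zQ zx yz; have := cs z y; rewrite !in_setD1 zx zQ => /(_ isT yz).
  by rewrite mem_cat negb_or => /andP[/andP[-> ->] /andP[-> ->]].
split; first split.
- move: us; rewrite cat_uniq /= => /and3P[_ _ ->]; rewrite andbT.
  by apply/negP => /sQ; rewrite eqxx.
- by move=> y; rewrite in_cons => /orP[/eqP-> //|/sQ/andP[]].
- move=> z y zQ; have [->|zx] := eqVneq z x; rewrite in_cons negb_or.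
    by case/cQ=> -> -> ->.
  by case/(cQ' z y zQ zx) => -> -> ->.
- move=> y yQ; rewrite in_cons negb_or => /andP[yx ys].
  have [yc|yc] := boolP (y \in ch x); first by exists x.
  have [||z] := vs y; first by rewrite in_setD1 yx.
    by rewrite mem_cat negb_or yc.
  by rewrite in_setD1 => /andP[_ zQ]; exists z.
- move=> z zQ; have [->|zx] := eqVneq z x; last by rewrite uc // in_setD1 zx.
  by move: us; rewrite cat_uniq => /andP[].
- move=> z z' y zQ z'Q.
  have [->|zx] := eqVneq z x; have [->|z'x] := eqVneq z' x => // yz yz'.
  + by have [_ _ _] := cQ' z' y z'Q z'x yz'; rewrite yz.
  + by have [_ _ _] := cQ' z y zQ zx yz; rewrite yz'.
  + by apply: ic yz yz'; rewrite in_setD1 ?zx ?z'x.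
exists (fun y => if y == x then 0%N else (rho y).+1) => z y zQ yz.
have [zx|zx] := eqVneq z x.
  by move: yz; rewrite zx => /cQ[/negPf->].
have [/negPf-> _ _ _] := cQ' z y zQ zx yz.
by rewrite ltnS; apply: rk => //; rewrite in_setD1 zx.
Qed.

(** Popping a vertex preserves the invariant, so the traversal can only fail by emptying the stack
    too early; the first hypothesis, a form of acyclicity, forbids this. *)
Lemma inv_traversal m Q s : (forall Q', forest_inv Q' [::] -> Q' = finset.set0) ->
  #|Q| = m -> forest_inv Q s -> traversal m Q s.
Proof.
move=> fin; elim: m Q s => [|m IH] Q [|x s] Qm inv //=.
- have /eqP := Qm; rewrite cards_eq0 => /eqP Q0.
  by have := fi_sub inv (mem_head x s); rewrite Q0 inE.
- by move: Qm; rewrite (fin _ inv) cards0.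
have xQ : x \in Q by apply: (fi_sub inv); rewrite mem_head.
rewrite xQ /=; apply: IH; first by move: Qm; rewrite (cardsD1 x) xQ => -[].
case: inv => us ss cs vs uc ic.
have cx z y : z \in Q -> y \in ch z -> [/\ y \in Q, y != x & y \notin s].
  by move=> zQ /(cs z y zQ); rewrite in_cons negb_or => /and3P[].
move: us => /= /andP[xs us]; split.
- rewrite cat_uniq us uc // andbT /=; apply/hasPn => y ys; apply/negP => yx.
  by have [_ _] := cx x y xQ yx; rewrite ys.
- move=> y; rewrite mem_cat in_setD1 => /orP[/(cx _ _ xQ)[-> ->] //|ys].
  rewrite ss ?in_cons ?ys ?orbT // andbT.
  by apply: contraNneq xs => <-.
- move=> z y; rewrite !in_setD1 => /andP[zx zQ] yz.
  have [-> -> /negPf ys] := cx z y zQ yz; rewrite mem_cat ys orbF /=.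
  by apply/negP => yx; rewrite (ic z x y) ?eqxx in zx.
- move=> y; rewrite in_setD1 mem_cat negb_or => /andP[yx yQ] /andP[yc ys].
  have [||z zQ yz] := vs y => //; first by rewrite in_cons negb_or yx.
  exists z => //; rewrite in_setD1 zQ andbT.
  by apply: contraNneq yc => <-.
- by move=> z; rewrite in_setD1 => /andP[_]; apply: uc.
- move=> z z' y; rewrite !in_setD1 => /andP[_ zQ] /andP[_ z'Q].
  exact: ic.
Qed.

End Traversal.

(** * Ordered trees and their parent functions *)

Section Ordered.
Variables d V N : nat.
Local Notation X := ('I_V + 'I_N)%type.
Local Notation E := (vertex V N).
Implicit Types (c : {ffun 'I_V -> {ffun 'I_d -> X}}) (r : X) (p : X -> E).

Definition children c (x : X) : seq X :=
  if x is inl b then codom (c b) else [::].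

(* r is the child of the root and c b k the k-th child of the internal vertex b. *)
Definition ordered_tree r c : bool :=
  traversal (children c) (V + N) [set: X]%SET [:: r].

(** The final [None] is a default for vertices that are nobody's child; in an ordered tree it is
    never reached. *)
Definition parent_of r c (x : X) : E :=
  if x == r then None
  else if [pick b | x \in codom (c b)] is Some b then Some (inl b) else None.

Definition compat p r c : Prop :=
  [/\ forall x, (p x == None) = (x == r),
      forall x b, (p x == Some (inl b)) = (x \in codom (c b)),
      forall x a, p x != Some (inr a)
    & forall b, injective (c b)].

Lemma card_labels : #|[set: X]%SET| = (V + N)%N.
Proof. by rewrite cardsT card_sum !card_ord. Qed.

Lemma uniq_codomP b c : uniq (codom (c b)) <-> injective (c b).
Proof. by split => [/injectiveP|/injectiveP]. Qed.

Lemma ordered_tree_compat r c : ordered_tree r c ->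
  compat (parent_of r c) r c /\
  exists rho : E -> nat,
    forall x, (rho (parent_of r c x) < rho (Some x))%N.
Proof.
case/(traversal_inv card_labels) => -[_ _ cs vs uc ic] [rho rk].
have H : compat (parent_of r c) r c.
  split.
  - move=> x; rewrite /parent_of; have [_|xr] := eqVneq x r => //.
    case: pickP => // no; have [||y _] := vs x; rewrite ?inE //.
    by case: y => // b; rewrite /= no.
  - move=> x b; rewrite /parent_of; have [->|xr] := eqVneq x r.
      apply/esym/negP => rb; have := cs (inl b) r.
      by rewrite !inE eqxx => /(_ isT rb).
    case: pickP => [b' xb'|->] //; apply/eqP/idP => [[<-] //|xb].
    by rewrite (ic (inl b) (inl b') x) ?inE.
  - by move=> x a; rewrite /parent_of; case: (x == r) => //; case: pickP.
  - by move=> b; apply/uniq_codomP/(uc (inl b)); rewrite inE.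
split=> //; exists (fun v => if v is Some x then (rho x).+1 else 0%N) => x.
have [_ h2 h3 _] := H; case E : (parent_of r c x) => [[b|a]|] //.
  by rewrite ltnS; apply: rk; rewrite ?inE //= -h2 E.
by have := h3 x a; rewrite E eqxx.
Qed.

Lemma compat_ordered_tree T p r c : is_tree T -> is_parent T p ->
  compat p r c -> ordered_tree r c.
Proof.
move=> tT [px _ _ TE] [h1 h2 h3 h4]; apply: inv_traversal card_labels _.
- move=> Q [_ _ cs vs _ _]; apply/setP => x; rewrite inE; apply/negP => xQ.
  (* With an empty stack, [Q] contains the parents and the children of its elements. So [A] is
     closed under adjacency but misses the root, and connectedness forces it to be empty. *)
  pose A : {set E} := [set Some z | z in Q]%SET.
  have clA : closed_mem (adj T) (mem A).
    apply: intro_closed; first exact: connect_adj_sym.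
    move=> u v; rewrite /adj /= TE => /imsetP[z _ uvE] /imsetP[x' x'Q uE].
    have uv : u != v.
      by apply/eqP => E0; move: (cards2 (p z) (Some z)); rewrite -uvE px E0 finset.setUid cards1.
    have : u \in [set p z; Some z]%SET by rewrite -uvE !inE eqxx.
    have : v \in [set p z; Some z]%SET by rewrite -uvE !inE eqxx orbT.
    rewrite !inE => /orP[]/eqP vE' /orP[]/eqP uE'; try by rewrite vE' uE' eqxx in uv.
    + move: uE'; rewrite uE => -[x'z]; have [b bQ zb] := vs x' x'Q isT.
      case: b bQ zb => [b|//] bQ /=; rewrite -h2 x'z => /eqP pz.
      by rewrite vE' pz; apply/imsetP; exists (inl b).
    + case: x' x'Q uE => [b|a] x'Q uE; last by have := h3 z a; rewrite -uE' uE eqxx.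
      have zb : z \in codom (c b) by rewrite -h2 -uE' uE.
      have /andP[zQ _] := cs (inl b) z x'Q zb.
      by rewrite vE'; apply/imsetP; exists z.
  have [_ con _] := tT; have := closed_connect clA (con (Some x) None).
  rewrite (imset_f (fun z => Some z) xQ) => /esym/imsetP[]//.
- split=> //.
  + by move=> x _; rewrite inE.
  + by case=> [b|//] y _ /=; rewrite !inE -h2 -h1 => /eqP->.
  + move=> y _; rewrite inE -h1; case E : (p y) => [[b|a]|] // _.
      by exists (inl b); rewrite ?inE //= -h2 E.
    by have := h3 y a; rewrite E eqxx.
  + by case=> [b|//] _; apply/uniq_codomP.
  + case=> [b|//] [b'|//] y _ _ /=; rewrite -!h2 => /eqP-> /eqP[->].
    by [].
Qed.

Lemma compat_parent_of p r c : compat p r c -> ordered_tree r c -> parent_of r c =1 p.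
Proof.
move=> [h1 h2 h3 _] /ordered_tree_compat[[k1 k2 k3 _] _] x.
case E : (p x) => [[b|a]|].
- by apply/eqP; rewrite k2 -h2 E.
- by have := h3 x a; rewrite E eqxx.
- by apply/eqP; rewrite k1 -h1 E.
Qed.

Lemma card_entering T p u : is_parent T p ->
  #|entering T u| = #|[set x | p x == u]%SET|.
Proof.
case=> px _ -> _; rewrite card_in_imset //.
move=> x z; rewrite !inE => /eqP xu /eqP zu e.
have [] // : Some x = Some z.
by apply: set2_injl e; rewrite eq_sym; [rewrite -xu|rewrite -zu].
Qed.

(** The entering edges of a vertex correspond to its children, and every vertex but the root has one
    further edge, the leaving one. Valences thus become numbers of children. *)
Lemma admissibleP T p : is_tree T -> is_parent T p ->
  admissible d T <->
  [/\ #|[set x | p x == None]%SET| = 1%N,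
      forall a, #|[set x | p x == Some (inr a)]%SET| = 0%N
    & forall b, #|[set x | p x == Some (inl b)]%SET| = d].
Proof.
move=> tT pT; have [_ pl _ _] := pT.
have v0 : valence T None = #|[set x | p x == None]%SET|.
  by rewrite valence_split (card_entering _ pT) leaving_root cards0 addn0.
have v1 x : valence T (Some x) = #|[set z | p z == Some x]%SET|.+1.
  by rewrite valence_split (card_entering _ pT) pl cards1 addn1.
split=> [[_ h0 ha hb]|[h0 ha hb]].
  split; first by rewrite -v0.
    by move=> a; have := ha a; rewrite v1 => -[].
  by move=> b; have := hb b; rewrite v1 => -[].
split=> // [|a|b]; first by rewrite v0.
  by rewrite v1 ha.
by rewrite v1 hb.
Qed.

Lemma admissible_ordered_tree r c : ordered_tree r c ->
  admissible d (parent_tree (parent_of r c)).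
Proof.
case/ordered_tree_compat => -[h1 h2 h3 h4] [rho rk].
have [tT pT] := rank_tree rk; apply/(admissibleP tT pT); split.
- by rewrite -(cards1 r); apply: eq_card => x; rewrite !inE h1.
- by move=> a; apply: eq_card0 => x; rewrite !inE (negPf (h3 x a)).
- move=> b; rewrite -[RHS](card_ord d) -(card_codom (h4 b)).
  by apply: eq_card => x; rewrite inE h2.
Qed.

(** The enumeration of entering edges built into [in_edge] is itself one ordering of the children;
    it serves as the reference ordering of [T]. *)
Lemma edge_order T p : (0 < d)%N -> is_tree T -> is_parent T p -> admissible d T ->
  exists r c, [/\ compat p r c, root_edge T = [set None; Some r]%SET
    & forall b k, in_edge T (internal N b) k
                  = [set Some (inl b); Some (c b k)]%SET].
Proof.
move=> d0 tT pT /(admissibleP tT pT)[k0 ka kb].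
have [px _ pe _] := pT.
have [r rE] : exists r, [set x | p x == None]%SET = [set r]%SET by apply/cards1P/eqP.
have pr x : (p x == None) = (x == r) by move/setP/(_ x): rE; rewrite !inE.
have sz b : size (enum (entering T (internal N b))) = d.
  by rewrite -cardE (card_entering _ pT) kb.
have ex (bk : 'I_V * 'I_d) : exists x, p x = Some (inl bk.1) /\
    in_edge T (internal N bk.1) bk.2 = [set Some (inl bk.1); Some x]%SET.
  case: bk => b k /=; have : in_edge T (internal N b) k \in entering T (internal N b).
    by rewrite -mem_enum; apply: mem_nth; rewrite sz.
  by rewrite pe => /imsetP[x]; rewrite inE => /eqP xE ->; exists x.
have [c0 c0P] := fin_all_exists ex.
pose c : {ffun 'I_V -> {ffun 'I_d -> X}} := [ffun b => [ffun k => c0 (b, k)]].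
have cP b k : p (c b k) = Some (inl b) /\
    in_edge T (internal N b) k = [set Some (inl b); Some (c b k)]%SET.
  by rewrite !ffunE; apply: c0P (b, k).
exists r, c; split; last by move=> b k; have [] := cP b k.
- split=> //.
  + move=> x b; apply/eqP/codomP => [xb|[k ->]]; last by have [] := cP b k.
    have : [set Some (inl b); Some x]%SET \in enum (entering T (internal N b)).
      by rewrite mem_enum pe; apply/imsetP; exists x; rewrite ?inE ?xb.
    case/(nthP finset.set0) => k; rewrite sz => kd kE; exists (Ordinal kd).
    have [pc] := cP b (Ordinal kd); rewrite /in_edge /= kE.
    move=> e; have [] // : Some x = Some (c b (Ordinal kd)).
    by apply: set2_injl e; rewrite eq_sym; [rewrite -xb|rewrite -pc].
  + move=> x a; apply/negP => xa; have /eqP := ka a; rewrite cards_eq0.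
    by move/eqP/setP/(_ x); rewrite !inE xa.
  + move=> b k l kl; have [_ e1] := cP b k; have [_ e2] := cP b l.
    apply/val_inj/eqP.
    rewrite -(nth_uniq finset.set0 _ _ (enum_uniq (entering T (internal N b))))
      ?sz ?ltn_ord //.
    by apply/eqP; have := e2; rewrite -kl -e1 => /esym.
- have : root_edge T \in entering T None.
    rewrite -mem_enum; apply: mem_nth; rewrite -cardE.
    by rewrite (card_entering _ pT) k0.
  by rewrite pe => /imsetP[x]; rewrite inE pr => /eqP -> ->.
Qed.

End Ordered.

(** * Amplitudes as sums over ordered trees *)

Section OrderedSum.
Variables (R : realType) (n d : nat).
Variable w : 'I_n -> {ffun 'I_d -> 'I_n} -> R[i].
Variable y : 'I_n -> R[i].
Variable i : 'I_n.
Variables V N : nat.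
Local Notation X := ('I_V + 'I_N)%type.
Local Notation E := (vertex V N).

(** The index of an edge is attached to the vertex that the edge leaves, so an index assignment is a
    function on the non-root vertices. *)
Definition ordered_amplitude (rc : X * {ffun 'I_V -> {ffun 'I_d -> X}}) : R[i] :=
  \sum_(f : {ffun X -> 'I_n} | f rc.1 == i)
    (\prod_(a < N) y (f (inr a))) *
    (\prod_(b < V) w (f (inl b)) [ffun k => f (rc.2 b k)]).

Lemma amplitude_ordered (T : {set {set E}}) p r c : is_tree T -> is_parent T p ->
  compat p r c -> root_edge T = [set None; Some r]%SET ->
  (forall b k, in_edge T (internal N b) k = [set Some (inl b); Some (c b k)]%SET) ->
  amplitude w y i T = ordered_amplitude (r, c).
Proof.
move=> tT [px pl pe TE] [h1 h2 h3 h4] rE cE.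
have pT x : [set p x; Some x]%SET \in T by rewrite TE; apply: imset_f.
(* [th] sends a vertex to its leaving edge. It is injective because the edge enters its other end,
   hence bijective by cardinality. *)
pose th x : edge_of T := exist _ [set p x; Some x]%SET (pT x).
have th_inj : injective th.
  move=> x z /(congr1 val) /= e; have : [set p x; Some x]%SET \in leaving T (Some x).
    by rewrite pl inE.
  have : [set p x; Some x]%SET \in leaving T (Some z) by rewrite e pl inE.
  rewrite !inE => /and3P[_ xz nz] /and3P[_ _ nx].
  case/orP: xz => [/eqP zp|/eqP[]//]; move: nz.
  have : [set p x; Some x]%SET \in entering T (p x).
    by rewrite pe; apply/imsetP; exists x; rewrite ?inE.
  by rewrite inE zp => /and3P[_ _ ->].
have th_bij : bijective th.
  apply: inj_card_bij th_inj _.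
  rewrite card_sig -[X in (X <= _)%N]/#|[pred e | e \in T]|.
  have -> : #|[pred e | e \in T]| = #|T| by apply: eq_card.
  by rewrite TE leq_imset_card.
have [iv thK ivK] := th_bij.
have eo x : out_edge T (Some x) = [set p x; Some x]%SET.
  by rewrite /out_edge pl enum_set1.
have ei (f : {ffun edge_of T -> 'I_n}) x : edge_index i f [set p x; Some x]%SET = f (th x).
  by rewrite /edge_index (insubT (fun e => e \in T) (pT x)).
have pr : p r = None by apply/eqP; rewrite h1.
have pc b k : p (c b k) = Some (inl b) by apply/eqP; rewrite h2 codom_f.
rewrite /amplitude /ordered_amplitude /=.
pose F (f : {ffun X -> 'I_n}) : {ffun edge_of T -> 'I_n} := [ffun e => f (iv e)].
have Fb : bijective F.
  exists (fun f : {ffun edge_of T -> 'I_n} => [ffun x => f (th x)]) => f; apply/ffunP => x; rewrite !ffunE.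
    by rewrite thK.
  by rewrite ivK.
rewrite (reindex F) /=; last exact: onW_bij.
apply: eq_big => f; first by rewrite rE -{1}pr ei ffunE thK.
move=> _; congr (_ * _); apply: eq_bigr.
  by move=> a _; rewrite eo ei ffunE thK.
move=> b _; rewrite eo ei ffunE thK; congr (w _ _); apply/ffunP => k.
by rewrite !ffunE cE -(pc b k) ei ffunE thK.
Qed.

(** Group the ordered trees by their underlying tree. The orderings of one tree arise from a
    reference ordering by permuting the children of each internal vertex, and the symmetry of [w]
    gives them all the same amplitude. *)
Lemma sum_ordered : (0 < d)%N -> symmetric_family w ->
  \sum_(rc | ordered_tree rc.1 rc.2) ordered_amplitude rc =
  (\sum_(T in admissible_trees d V N) amplitude w y i T) *+ (d`! ^ V).
Proof.
move=> d0 sw; pose tr (rc : X * {ffun 'I_V -> {ffun 'I_d -> X}}) :=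
  parent_tree (parent_of rc.1 rc.2).
rewrite (partition_big tr (mem (admissible_trees d V N))) /=; last first.
  by move=> rc /admissible_ordered_tree h; rewrite inE; apply/asboolP.
rewrite -sumrMnl; apply: eq_bigr => T; rewrite inE => /asboolP adT.
have tT : is_tree T by case: adT.
have [p pT] := tree_parent tT.
have [r [c [co rE cE]]] := edge_order d0 tT pT adT.
rewrite (amplitude_ordered tT pT co rE cE).
have [h1 h2 h3 h4] := co.
pose h (s : {ffun 'I_V -> 'S_d}) : X * {ffun 'I_V -> {ffun 'I_d -> X}} :=
  (r, [ffun b => [ffun k => c b (s b k)]]).
have h_inj : injective h.
  move=> s s' [/ffunP e]; apply/ffunP => b; apply/permP => k.
  by have /ffunP/(_ k) := e b; rewrite !ffunE => /h4.
(* Ordered trees over [T] share its parent function, so they have the same [r] and their lists of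
   children of [b] are two injective enumerations of one set. *)
have fib rc : (ordered_tree rc.1 rc.2 && (tr rc == T)) =
    (rc \in [set h s | s in [set: {ffun 'I_V -> 'S_d}]])%SET.
  apply/andP/imsetP => [[vrc /eqP trT]|[s _ ->]].
    have [[k1 k2 k3 k4] [rho rk]] := ordered_tree_compat vrc.
    have [_ pT'] := rank_tree rk; rewrite -/(tr rc) trT in pT'.
    have pE := parent_inj pT' pT.
    case: rc vrc trT k1 k2 k3 k4 rk pT' pE => [r' c'] /= vrc trT k1 k2 k3 k4 rk pT' pE.
    have rr : r' = r by apply/eqP; rewrite -h1 -pE k1.
    have ex (b : 'I_V) : exists s : 'S_d, forall k, c' b k = c b (s k).
      have /fin_all_exists[s0 s0P] : forall k, exists l, c' b k = c b l.
        by move=> k; apply/codomP; rewrite -h2 -pE k2 codom_f.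
      have s0i : injective s0 by move=> k l e; apply: (k4 b); rewrite !s0P e.
      by exists (perm s0i) => k; rewrite permE.
    have [s sP] := fin_all_exists ex.
    exists [ffun b => s b]; rewrite ?inE // /h rr; congr (_, _).
    by apply/ffunP => b; apply/ffunP => k; rewrite !ffunE sP.
  have co' : compat p (h s).1 (h s).2.
    split=> //.
    + move=> x b; rewrite h2 /=; apply/codomP/codomP => -[k ->].
        by exists ((s b)^-1%g k); rewrite !ffunE permKV.
      by exists (s b k); rewrite !ffunE.
    + by move=> b k l; rewrite !ffunE => /h4/perm_inj.
  have vs := compat_ordered_tree tT pT co'; split=> //.
  have [_ _ _ TE] := pT; rewrite /tr TE /parent_tree; apply/eqP/eq_imset => x.
  by rewrite (compat_parent_of co' vs).
rewrite (eq_bigl _ _ fib) big_imset /=; last by move=> s s' _ _; apply: h_inj.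
rewrite (eq_bigr (fun=> ordered_amplitude (r, c))).
  by rewrite sumr_const cardsT card_ffun card_Sn card_ord.
move=> s _; apply: eq_bigr => f _; congr (_ * _); apply: eq_bigr => b _ /=.
rewrite -[RHS](sw _ (s b)); congr (w _ _); apply/ffunP => k.
by rewrite !ffunE.
Qed.

End OrderedSum.

(** * The recursion removing one label *)

Section SumSeq.
Variables (K : pzSemiRingType) (X : finType).
Implicit Type G : seq X -> K.

(** The summand takes a sequence rather than a tuple, so that concatenated stacks need no casts
    between lengths. *)
Definition sum_seq k G : K := \sum_(t : k.-tuple X) G t.

Lemma sum_seq0 G : sum_seq 0 G = G [::].
Proof.
rewrite /sum_seq (big_pred1 [tuple]) // => t.
by apply/esym/eqP; apply: tuple0.
Qed.

Lemma sum_seqS k G : sum_seq k.+1 G = \sum_x sum_seq k (fun s => G (x :: s)).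
Proof.
rewrite /sum_seq pair_big /=.
rewrite (reindex (fun p : X * k.-tuple X => [tuple of p.1 :: p.2])) //=.
exists (fun t : k.+1.-tuple X => (thead t, [tuple of behead t])) => [[x t] _|t _] /=.
  by congr (_, _); apply: val_inj.
by rewrite [RHS]tuple_eta; apply: val_inj.
Qed.

Lemma sum_seqD a b G :
  sum_seq (a + b) G = sum_seq a (fun s => sum_seq b (fun t => G (s ++ t))).
Proof.
elim: a G => [|a IH] G; first by rewrite sum_seq0.
rewrite addSn !sum_seqS; apply: eq_bigr => x _; exact: IH.
Qed.

Lemma sum_seq_codom k G :
  sum_seq k G = \sum_(v : {ffun 'I_k -> X}) G (codom v).
Proof.
rewrite /sum_seq (reindex (fun v : {ffun 'I_k -> X} => [tuple v j | j < k])) //=.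
exists (fun t : k.-tuple X => [ffun j => tnth t j]) => [v _|t _].
  by apply/ffunP => j; rewrite ffunE tnth_mktuple.
by apply: eq_from_tnth => j; rewrite tnth_mktuple ffunE.
Qed.

End SumSeq.

Lemma sum_prod (K : pzSemiRingType) (A B : finType) (F : A * B -> K) :
  \sum_p F p = \sum_a \sum_b F (a, b).
Proof. by rewrite pair_bigA; apply: eq_bigr => -[]. Qed.

(** * Sums over functions frozen outside a set *)

Section Supported.
Variables (K : pzSemiRingType) (B D : finType) (h0 : D).
Implicit Types (S : {set B}) (h : {ffun B -> D}).

Definition supp_on S h := [forall b, (b \notin S) ==> (h b == h0)].

Definition upd h b v : {ffun B -> D} := [ffun b' => if b' == b then v else h b'].

Lemma supp_on0 h : supp_on finset.set0 h = (h == [ffun=> h0]).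
Proof.
apply/forallP/eqP => [s|-> b]; last by rewrite ffunE eqxx implybT.
by apply/ffunP => b; have := s b; rewrite ffunE inE => /eqP.
Qed.

Lemma supp_onT h : supp_on [set: B]%SET h.
Proof. by apply/forallP => b; rewrite inE. Qed.

Lemma sum_supp_peel S b (F : {ffun B -> D} -> K) : b \in S ->
  \sum_(h | supp_on S h) F h =
  \sum_v \sum_(h | supp_on (S :\ b)%SET h) F (upd h b v).
Proof.
move=> bS; rewrite pair_big_dep /=.
rewrite (reindex_onto (fun p : D * {ffun B -> D} => upd p.2 b p.1)
  (fun h => (h b, upd h b h0))) /=; last first.
  by move=> h _; apply/ffunP => b'; rewrite !ffunE; case: eqP => // ->.
apply: eq_bigl => -[v h] /=; rewrite xpair_eqE ffunE eqxx eqxx /=.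
apply/andP/forallP => [[/forallP s /eqP/ffunP e] b'|s].
  apply/implyP; rewrite in_setD1 negb_and negbK => /orP[/eqP ->|nb].
    by have := e b; rewrite !ffunE eqxx => <-.
  by have := s b'; rewrite nb ffunE ifN //; apply: contraNneq nb => ->.
split; first apply/forallP => b'.
  apply/implyP => nb; have bb : b' != b by apply: contraNneq nb => ->.
  by have := s b'; rewrite ffunE ifN // in_setD1 bb nb.
apply/eqP/ffunP => b'; rewrite !ffunE; case: eqVneq => // ->.
by have := s b; rewrite in_setD1 eqxx => /eqP.
Qed.

End Supported.

(** * Weights of traversals with prescribed stack indices *)

Section StackSum.
Variables (K : comPzSemiRingType) (n d : nat).
Variable w : 'I_n -> {ffun 'I_d -> 'I_n} -> K.
Variable y : 'I_n -> K.
Variables V N : nat.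
Local Notation X := ('I_V + 'I_N)%type.
Local Notation D := ('I_n * {ffun 'I_d -> X})%type.
Implicit Types (S : {set 'I_V}) (L : {set 'I_N}) (s : seq X) (I : seq 'I_n).
Implicit Types (h : {ffun 'I_V -> D}) (g : {ffun 'I_N -> 'I_n}).

(* h b is the pair of the index of the edge leaving b and of the children of b,
   g a the index of the edge leaving a, and I lists the indices imposed on the
   vertices of the stack s.  Only the values of h on S and of g on L matter;
   elsewhere they are frozen to the default h0 in stack_sum. *)
Fixpoint stack_weight m S L s I h g : K :=
  match m, s, I with
  | 0, [::], [::] => 1
  | m'.+1, inr a :: s', i :: I' =>
      if (a \in L) && (g a == i)
      then y i * stack_weight m' S (L :\ a)%SET s' I' h g else 0
  | m'.+1, inl b :: s', i :: I' =>
      if (b \in S) && ((h b).1 == i)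
      then \sum_(j : {ffun 'I_d -> 'I_n})
             w i j * stack_weight m' (S :\ b)%SET L (codom (h b).2 ++ s')
                       (codom j ++ I') h g
      else 0
  | _, _, _ => 0
  end.

Definition label h g (x : X) : 'I_n :=
  match x with inl b => (h b).1 | inr a => g a end.

Definition total_weight S L h g : K :=
  (\prod_(a in L) y (g a)) *
  (\prod_(b in S) w (h b).1 [ffun k => label h g ((h b).2 k)]).

Definition label_set S L : {set X} :=
  [set x : X | match x with inl b => b \in S | inr a => a \in L end]%SET.

Definition child_labels h : {ffun 'I_V -> {ffun 'I_d -> X}} := [ffun b => (h b).2].

(** The traversal collects one factor [y] or [w] per visited vertex. Of the sum over [j] at an
    internal vertex only the term [j0], the true labels of the children, survives the later
    comparisons. *)
Lemma stack_weightE m S L s I h g : (#|S| + #|L|)%N = m ->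
  stack_weight m S L s I h g =
  if traversal (children (child_labels h)) m (label_set S L) s && (map (label h g) s == I)
  then total_weight S L h g else 0.
Proof.
elim: m S L s I => [|m IH] S L [|x s] [|i I] Em //=; rewrite ?andbF //.
- move/eqP: Em; rewrite addn_eq0 !cards_eq0 => /andP[/eqP-> /eqP->].
  by rewrite /total_weight !big_set0 mulr1.
- by case: x.
rewrite eqseq_cons; case: x => [b|a] /=; rewrite inE.
- have [bS|] //= := boolP (b \in S).
  have [hb|] := eqVneq (h b).1 i; last by rewrite andbF.
  have Em' : (#|(S :\ b)%SET| + #|L|)%N = m.
    by move: Em; rewrite (cardsD1 b) bS add1n addSn => -[].
  have -> : (label_set S L :\ inl b)%SET = label_set (S :\ b) L.
    apply/setP => -[b'|a']; rewrite !inE //=.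
  rewrite ffunE; set j0 : {ffun 'I_d -> 'I_n} := [ffun k => label h g ((h b).2 k)].
  have ej (j : {ffun 'I_d -> 'I_n}) : (map (label h g) (codom (h b).2) == codom j) = (j == j0).
    apply/eqP/eqP => [e|->].
      move: e; rewrite -[map _ _]map_comp => /eq_in_map ee.
      by apply/ffunP => k; rewrite /j0 ffunE -ee ?mem_enum.
    by rewrite -[LHS]map_comp; apply: eq_map => k; rewrite /= /j0 ffunE.
  rewrite (bigD1 j0) //= big1 ?addr0.
    rewrite IH // map_cat eqseq_cat ?size_map ?size_codom // ej eqxx /=.
    case: ifP => _; last by rewrite mulr0.
    by rewrite /total_weight [X in _ = _ * X](big_setD1 b) //= hb mulrCA.
  move=> j jj; rewrite IH // map_cat eqseq_cat ?size_map ?size_codom //.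
  by rewrite ej (negPf jj) andbF mulr0.
- have [aL|] //= := boolP (a \in L).
  have [ga|] := eqVneq (g a) i; last by rewrite andbF.
  have Em' : (#|S| + #|(L :\ a)%SET|)%N = m.
    by move: Em; rewrite [#|L|](cardsD1 a) aL add1n addnS => -[].
  have -> : (label_set S L :\ inr a)%SET = label_set S (L :\ a).
    apply/setP => -[b'|a']; rewrite !inE //=.
  rewrite IH //=; case: ifP => _; last by rewrite mulr0.
  by rewrite /total_weight [in RHS](big_setD1 a) //= ga mulrA.
Qed.

Lemma eq_stack_weight m S L s I h h' g g' :
  {in S, h =1 h'} -> {in L, g =1 g'} ->
  stack_weight m S L s I h g = stack_weight m S L s I h' g'.
Proof.
elim: m S L s I => [|m IH] S L [|x s] [|i I] //= eh eg; case: x => [b|a] //.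
  case bS: (b \in S) => //=; rewrite eh //; case: ifP => // _.
  apply: eq_bigr => j _; rewrite IH // => b'; rewrite inE => /andP[_].
  exact: eh.
case aL: (a \in L) => //=; rewrite eg //; case: ifP => // _.
by rewrite IH // => a'; rewrite inE => /andP[_]; apply: eg.
Qed.

Variable (h0 : D).
Local Notation i0 := (h0.1).

Definition stack_sum m S L I : K :=
  sum_seq (size I) (fun s => \sum_(h | supp_on h0 S h)
    \sum_(g | supp_on i0 L g) stack_weight m S L s I h g).

(** The top of the stack is a leaf [a], which disappears, or an internal vertex [b], replaced by
    children with indices [j]. As the names on the stack are summed over, only their indices remain
    and the recursion closes. *)
Lemma stack_sum_cons m S L i I : stack_sum m.+1 S L (i :: I) =
  (\sum_(a in L) y i * stack_sum m S (L :\ a)%SET I) +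
  \sum_(b in S) \sum_(j : {ffun 'I_d -> 'I_n})
    w i j * stack_sum m (S :\ b)%SET L (codom j ++ I).
Proof.
rewrite /stack_sum /= sum_seqS big_sumType /= addrC; congr (_ + _).
- rewrite [RHS]big_mkcond; apply: eq_bigr => a _.
  case aL: (a \in L); last first.
    apply: big1 => t _; apply: big1 => h _; apply: big1 => g _ //=.
  rewrite [RHS]big_distrr /=; apply: eq_bigr => t _.
  rewrite [RHS]big_distrr /=; apply: eq_bigr => h _.
  rewrite (sum_supp_peel i0 _ aL) (bigD1 i) //= [X in _ + X]big1 ?addr0.
    rewrite [RHS]big_distrr /=; apply: eq_bigr => g _.
    rewrite ffunE !eqxx; congr (_ * _); apply: eq_stack_weight => // a'.
    by rewrite in_setD1 ffunE => /andP[/negPf->].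
  by move=> v vi; apply: big1 => g _; rewrite ffunE eqxx (negPf vi).
- rewrite [RHS]big_mkcond; apply: eq_bigr => b _.
  case bS: (b \in S); last first.
    by apply: big1 => t _; apply: big1 => h _; apply: big1 => g _.
  (* On the left [v] is the list of children in [h b], whose index is forced to be [i]; on the right
     it is the first [d] entries of the new stack. *)
  transitivity (\sum_(v : {ffun 'I_d -> X}) sum_seq (size I) (fun s =>
    \sum_(j : {ffun 'I_d -> 'I_n}) \sum_(h | supp_on h0 (S :\ b)%SET h)
     \sum_(g | supp_on i0 L g) w i j * stack_weight m (S :\ b)%SET L (codom v ++ s)
       (codom j ++ I) h g)).
    rewrite /sum_seq [RHS]exchange_big /=; apply: eq_bigr => t _.
    rewrite (sum_supp_peel h0 _ bS).
    rewrite sum_prod.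
    rewrite (bigD1 i) //= [X in _ + X]big1 ?addr0; last first.
      move=> i' ii; apply: big1 => v _; apply: big1 => h _; apply: big1 => g _.
      by rewrite ffunE eqxx (negPf ii).
    apply: eq_bigr => v _; rewrite [RHS]exchange_big /=; apply: eq_bigr => h _.
    rewrite [RHS]exchange_big /=; apply: eq_bigr => g _.
    rewrite ffunE !eqxx /=; apply: eq_bigr => j _; congr (_ * _).
    apply: eq_stack_weight => // b'; by rewrite in_setD1 ffunE => /andP[/negPf->].
  under [RHS]eq_bigr => j _ do
    rewrite size_cat size_codom card_ord sum_seqD sum_seq_codom big_distrr /=.
  rewrite [RHS]exchange_big /=; apply: eq_bigr => v _.
  rewrite /sum_seq; under [RHS]eq_bigr => j _ do rewrite big_distrr /=.
  rewrite [RHS]exchange_big /=; apply: eq_bigr => t _. apply: eq_bigr => j _.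
  rewrite big_distrr; apply: eq_bigr => h _; rewrite big_distrr.
  by apply: eq_bigr => g _.
Qed.

Lemma stack_sum0 S L I : #|S| = 0%N -> #|L| = 0%N ->
  stack_sum 0 S L I = (size I == 0%N)%:R.
Proof.
move=> /eqP; rewrite cards_eq0 => /eqP -> /eqP; rewrite cards_eq0 => /eqP ->.
case: I => [|i I].
  rewrite /stack_sum sum_seq0 /=.
  rewrite (big_pred1 [ffun=> h0]); last by move=> h; rewrite supp_on0.
  by rewrite (big_pred1 [ffun=> i0]) // => h; rewrite supp_on0.
rewrite /stack_sum /= sum_seqS; apply: big1 => x _; apply: big1 => t _.
by apply: big1 => h _; apply: big1.
Qed.

Lemma stack_sum_nil m S L : stack_sum m.+1 S L [::] = 0.
Proof.
by rewrite /stack_sum sum_seq0; apply: big1 => h _; apply: big1.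
Qed.

End StackSum.

(** * Generating polynomials of plane trees of bounded height *)

Section HeightPoly.
Variables (K : numFieldType) (n d : nat).
Variable w : 'I_n -> {ffun 'I_d -> 'I_n} -> K.
Variable y : 'I_n -> K.
Implicit Types (P : seq (nat * 'I_n)).

Fixpoint height_poly m (i : 'I_n) : {poly K} :=
  if m is m'.+1 then
    (y i)%:P + 'X * (d`!%:R^-1 *:
      \sum_(j : {ffun 'I_d -> 'I_n}) w i j *: \prod_(k < d) height_poly m' (j k))
  else 0.

(** Each tree of the forest carries its own height bound: expanding the first tree lowers the bound
    for its children only. *)
Definition forest_poly P : {poly K} := \prod_(q <- P) height_poly q.1 q.2.

Definition at_height m (j : {ffun 'I_d -> 'I_n}) : seq (nat * 'I_n) :=
  [seq (m, i) | i <- codom j].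

Lemma size_at_height m j : size (at_height m j) = d.
Proof. by rewrite size_map size_codom card_ord. Qed.

Lemma coef_forest_poly_cons m i P v :
  (forest_poly ((m.+1, i) :: P))`_v = y i * (forest_poly P)`_v +
    (if v is v'.+1 then d`!%:R^-1 *
       \sum_(j : {ffun 'I_d -> 'I_n}) w i j * (forest_poly (at_height m j ++ P))`_v'
     else 0).
Proof.
rewrite /forest_poly big_cons /= mulrDl coefD mul_polyC coefZ -mulrA coefXM.
congr (_ + _); case: v => [|v] //=.
rewrite -scalerAl coefZ mulr_suml coef_sum; congr (_ * _).
by apply: eq_bigr => j _; rewrite -scalerAl coefZ big_cat /at_height codomE !big_map.
Qed.

Section StackSumFormula.
Variables V N : nat.
Variable h0 : 'I_n * {ffun 'I_d -> 'I_V + 'I_N}.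

(** Both sides obey the same recursion, and the sums over [a] and [b] contribute the factors of the
    factorials. The power of [d!] makes up for the [1 / d!] in [height_poly]; the tested equality is
    the leaf count of a forest with [size P] roots; height bounds above [#|S|] exclude no tree. *)
Lemma stack_sumE m (S : {set 'I_V}) (L : {set 'I_N}) P : (0 < d)%N ->
  (#|S| + #|L|)%N = m -> all (fun q => #|S| < q.1)%N P ->
  stack_sum w y h0 m S L [seq q.2 | q <- P] =
  if #|L| == (d.-1 * #|S| + size P)%N
  then ((#|S|)`! * (#|L|)`! * d`! ^ #|S|)%:R * (forest_poly P)`_#|S| else 0.
Proof.
move=> d0; elim: m S L P => [|m IH] S L [|[m0 i] P] Em.
- move: Em => /eqP; rewrite addn_eq0 => /andP[/eqP S0 /eqP L0] _.
  by rewrite stack_sum0 // S0 L0 muln0 /forest_poly big_nil coef1 !mulr1.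
- move: Em => /eqP; rewrite addn_eq0 => /andP[/eqP S0 /eqP L0] _.
  by rewrite stack_sum0 // S0 L0 muln0.
- move=> _; rewrite stack_sum_nil /forest_poly big_nil coef1.
  case S0 : #|S| Em => [|s] Em; last by rewrite mulr0 if_same.
  by move: Em; rewrite add0n => ->; rewrite muln0.
case/andP => /= m0S aP; case: m0 m0S => // m0; rewrite ltnS => m0S.
rewrite stack_sum_cons coef_forest_poly_cons.
(* [A] and [B] are the values given by the induction hypothesis after removing a leaf or an internal
   vertex; they depend on cardinals only, not on the label removed. *)
pose A := if #|L|.-1 == (d.-1 * #|S| + size P)%N
  then ((#|S|)`! * #|L|.-1`! * d`! ^ #|S|)%:R * (forest_poly P)`_#|S| else 0.
pose B (j : {ffun 'I_d -> 'I_n}) := if #|L| == (d.-1 * #|S|.-1 + (d + size P))%N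
  then (#|S|.-1`! * (#|L|)`! * d`! ^ #|S|.-1)%:R *
       (forest_poly (at_height m0 j ++ P))`_#|S|.-1 else 0.
rewrite (eq_bigr (fun=> y i * A)); last first.
  move=> a aL; have cL : #|(L :\ a)%SET| = #|L|.-1 by rewrite [#|L|](cardsD1 a) aL.
  rewrite IH // ?cL //.
  by move: Em; rewrite [#|L|](cardsD1 a) aL addnS => -[].
rewrite [X in _ + X](eq_bigr (fun=> \sum_j w i j * B j)); last first.
  move=> b bS; apply: eq_bigr => j _; congr (_ * _).
  have cS : #|(S :\ b)%SET| = #|S|.-1 by rewrite [#|S|](cardsD1 b) bS.
  have S1 : (0 < #|S|)%N by rewrite (cardsD1 b) bS.
  have -> : codom j ++ [seq q.2 | q <- P] = [seq q.2 | q <- at_height m0 j ++ P].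
    by rewrite map_cat -map_comp map_id.
  rewrite IH ?cS //.
  - by rewrite size_cat size_at_height.
  - by move: Em; rewrite (cardsD1 b) bS => -[<-]; rewrite cS.
  - rewrite all_cat; apply/andP; split.
      by apply/allP => q /mapP[k _ ->] /=; rewrite prednK.
    by apply: sub_all aP => q /=; apply: leq_ltn_trans (leq_pred _).
rewrite !sumr_const /A /B; move: #|S| #|L| Em m0S aP {IH A B} => s l Em m0S aP.
case: s Em m0S aP => [|s] Em m0S aP /=.
  rewrite mulr0n !addr0 muln0 !add0n; case: l Em => [|l] Em //=.
  rewrite eqSS; case: eqP => _; last by rewrite mulr0 mul0rn.
  rewrite factS !expn0 !muln1 fact0 !mul1n natrM -mulr_natl; ring.
have -> : (d.-1 * s + (d + size P) = d.-1 * s.+1 + (size P).+1)%N.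
  by rewrite mulnS -{2}(prednK d0); lia.
have d1 : d`!%:R != 0 :> K by rewrite pnatr_eq0 -lt0n fact_gt0.
case: l Em => [|l] Em /=.
  rewrite mulr0n add0r addnS /=; under eq_bigr do rewrite mulr0.
  by rewrite big1_eq mul0rn.
rewrite addnS eqSS; case: eqP => _; last first.
  rewrite mulr0 mul0rn add0r; under eq_bigr do rewrite mulr0.
  by rewrite big1_eq mul0rn.
set c1 := (forest_poly P)`_ _.
under eq_bigr do rewrite mulrCA.
rewrite -mulr_sumr; set c2 := \sum_j _.
rewrite -(mulr_natl (y i * _)) -(mulr_natl (_ * c2)) expnS !factS !natrM. field.
exact: d1.
Qed.

End StackSumFormula.
End HeightPoly.

(** * The sum of all amplitudes as a coefficient *)

Section TreeSum.
Variables (R : realType) (n d : nat).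
Variable w : 'I_n -> {ffun 'I_d -> 'I_n} -> R[i].
Variable y : 'I_n -> R[i].
Variable i : 'I_n.

Lemma ordered_stack_sum V N (h0 : 'I_n * {ffun 'I_d -> 'I_V + 'I_N}) :
  \sum_(rc : ('I_V + 'I_N) * {ffun 'I_V -> {ffun 'I_d -> 'I_V + 'I_N}}
      | ordered_tree rc.1 rc.2) ordered_amplitude w y i rc =
  stack_sum w y h0 (V + N) [set: 'I_V]%SET [set: 'I_N]%SET [:: i].
Proof.
rewrite /stack_sum /= sum_seqS big_mkcond sum_prod; apply: eq_bigr => r _ /=.
rewrite sum_seq0 pair_big /=.
(* [phi] repacks the children and the indices of all vertices as the pair [(h, g)] used by the stack
   weights. *)
pose phi (cf : {ffun 'I_V -> {ffun 'I_d -> 'I_V + 'I_N}} * {ffun 'I_V + 'I_N -> 'I_n}) :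
  {ffun 'I_V -> 'I_n * {ffun 'I_d -> 'I_V + 'I_N}} * {ffun 'I_N -> 'I_n} :=
  ([ffun b => (cf.2 (inl b), cf.1 b)], [ffun a => cf.2 (inr a)]).
rewrite (reindex phi) /=; last first.
  exists (fun hg : {ffun 'I_V -> 'I_n * {ffun 'I_d -> 'I_V + 'I_N}} * {ffun 'I_N -> 'I_n} =>
      ([ffun b => (hg.1 b).2], [ffun x => label hg.1 hg.2 x])) => -[c f] _ /=.
    by congr (_, _); apply/ffunP; [move=> b|case=> [b|a]]; rewrite ffunE /= ffunE.
  by rewrite /phi /=; congr (_, _); apply/ffunP => b; rewrite !ffunE //=; case: (c b).
under [RHS]eq_bigl => cf do rewrite !supp_onT.
rewrite sum_prod; apply: eq_bigr => c _; rewrite /ordered_amplitude big_mkcond /=.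
have lab f x : label (phi (c, f)).1 (phi (c, f)).2 x = f x.
  by case: x => ?; rewrite /= ffunE.
have chl f : child_labels (phi (c, f)).1 = c by apply/ffunP => b; rewrite !ffunE.
have lsT : label_set [set: 'I_V]%SET [set: 'I_N]%SET = [set: _]%SET.
  by apply/setP => -[b|a]; rewrite !inE.
transitivity (\sum_(f : {ffun 'I_V + 'I_N -> 'I_n}) (if ordered_tree r c && (f r == i) then
    (\prod_(a < N) y (f (inr a))) *
    (\prod_(b < V) w (f (inl b)) [ffun k => f (c b k)]) else 0)).
  by case: ordered_tree => //=; rewrite big1_eq.
apply: eq_bigr => f _; rewrite stack_weightE ?cardsT ?card_ord // lsT.
rewrite -/(phi (c, f)).1 -/(phi (c, f)).2 chl /= lab eqseq_cons andbT /ordered_tree.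
case: ifP => // _; rewrite /total_weight; congr (_ * _).
  by apply: eq_big => a; rewrite ?inE // ffunE.
apply: eq_big => b; rewrite ?inE // => _; rewrite ffunE /=; congr (w _ _).
by apply/ffunP => k; rewrite !ffunE lab.
Qed.

Lemma tree_sum V N m : (0 < d)%N -> symmetric_family w -> (V < m)%N ->
  \sum_(T in admissible_trees d V N) amplitude w y i T =
  if N == (d.-1 * V + 1)%N then (V`! * N`!)%:R * (height_poly w y m i)`_V else 0.
Proof.
move=> d0 sw Vm.
have d1 : (d`! ^ V)%:R != 0 :> R[i] by rewrite pnatr_eq0 -lt0n expn_gt0 fact_gt0.
apply: (mulfI d1); rewrite [LHS]mulr_natl -sum_ordered //.
(* Without any label the root has no possible child and both sides vanish; otherwise some [x0]
   exists to build the default value [h0]. *)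
have [/eqP|] := posnP (V + N)%N.
  rewrite addn_eq0 => /andP[/eqP V0 /eqP N0]; subst V N.
  by rewrite big1 ?muln0 ?mulr0 // => -[[[]|[]]].
move=> VN.
have x0 : 'I_V + 'I_N.
  case: V Vm d1 VN => [|V'] ? ? VN; last exact: inl ord0.
  exact: inr (Ordinal VN).
rewrite (ordered_stack_sum (i, [ffun=> x0])).
have := @stack_sumE _ n d w y V N (i, [ffun=> x0]) (V + N) [set: 'I_V]%SET [set: 'I_N]%SET [:: (m, i)] d0.
rewrite !cardsT !card_ord /= andbT => -> //.
case: ifP => _; last by rewrite mulr0.
by rewrite /forest_poly big_seq1 natrM mulrAC mulrC.
Qed.

End TreeSum.

(** * Bounds and limits *)

Section CoefBound.
Variables (K : numFieldType) (n d : nat).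
Variable w : 'I_n -> {ffun 'I_d -> 'I_n} -> K.
Variable y : 'I_n -> K.
Variables Y W : K.
Hypothesis d0 : (0 < d)%N.
Hypothesis yY : forall i, `|y i| <= Y.
Hypothesis wW : forall i, d`!%:R^-1 * \sum_j `|w i j| <= W.

Lemma norm_average_le i (c : {ffun 'I_d -> 'I_n} -> K) B : (forall j, `|c j| <= B) ->
  `|d`!%:R^-1 * \sum_j w i j * c j| <= W * B.
Proof.
move=> cB; have B0 : 0 <= B by apply: le_trans (cB [ffun=> i]).
rewrite normrM ger0_norm ?invr_ge0 ?ler0n //.
apply: le_trans (ler_wpM2r B0 (wW i)); rewrite -mulrA mulr_suml.
rewrite ler_wpM2l ?invr_ge0 ?ler0n //; apply: le_trans (ler_norm_sum _ _ _) _.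
by apply: ler_sum => j _; rewrite normrM ler_wpM2l.
Qed.

(* A tree with v nodes has d v + 1 vertices; the factor 2 ^ (number of vertices - 1)
   counts the words recording which vertices of a preorder traversal are leaves,
   the last one being necessarily a leaf. *)
Lemma coef_forest_bound P v : P != [::] ->
  `|(forest_poly w y P)`_v| <=
    Y ^+ (d.-1 * v + size P) * W ^+ v * 2 ^+ (d * v + size P).-1.
Proof.
have Y0 (i : 'I_n) : 0 <= Y by apply: le_trans (yY i).
have W0 (i : 'I_n) : 0 <= W.
  by apply: le_trans (wW i); rewrite mulr_ge0 ?invr_ge0 ?ler0n ?sumr_ge0.
(* Removing a leaf shortens [P] at constant [v], while expanding a node lowers [v] and lengthens
   [P]: hence the nested inductions. *)
elim: v P => [|v IHv] P; elim: P => [|[[|m] i] P IHP] // _.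
- have {}Y0 := Y0 i; have {}W0 := W0 i.
  by rewrite /forest_poly big_cons /= mul0r coef0 normr0 !mulr_ge0 ?exprn_ge0 ?ler0n.
- have {}Y0 := Y0 i; have {}W0 := W0 i.
  rewrite coef_forest_poly_cons addr0 normrM !muln0 !add0n expr0 mulr1.
  case: P IHP => [|p P] IHP.
    by rewrite /forest_poly big_nil coef1 normr1 !mulr1; apply: yY.
  apply: le_trans (ler_pM _ _ (yY i) (IHP isT)) _ => //.
  rewrite !muln0 !add0n /= !mulr1 mulrA -exprS ler_wpM2l ?exprn_ge0 //.
  by rewrite [in leRHS]exprS ler_peMl ?exprn_ge0 ?ler1n ?ler0n.
- have {}Y0 := Y0 i; have {}W0 := W0 i.
  by rewrite /forest_poly big_cons /= mul0r coef0 normr0 !mulr_ge0 ?exprn_ge0 ?ler0n.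
have {}Y0 := Y0 i; have {}W0 := W0 i.
rewrite coef_forest_poly_cons; apply: le_trans (ler_normD _ _) _.
set B := Y ^+ (d.-1 * v.+1 + (size P).+1) * W ^+ v.+1.
have eN : (d * v.+1 + (size P).+1).-1 = (d * v.+1 + size P).-1.+1.
  by rewrite addnS prednK // mulnS -addnA addn_gt0 d0.
(* One factor 2 is split into two equal halves, one for the case of a leaf and one for the case of a
   node. *)
rewrite [X in _ <= B * 2 ^+ X]eN exprS mulrA mulrAC mulr2n mulrDr !mulr1.
apply: lerD; last first.
  apply: le_trans (@norm_average_le i _ (Y ^+ (d.-1 * v + (d + size P)) * W ^+ v *
    2 ^+ (d * v + (d + size P)).-1) _) _.
    move=> j; have := IHv (at_height m j ++ P).
    rewrite -size_eq0 size_cat size_at_height; apply.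
    by rewrite addn_eq0 negb_and -lt0n d0.
  rewrite /B.
  have -> : (d.-1 * v + (d + size P) = d.-1 * v.+1 + (size P).+1)%N.
    by rewrite mulnS -{2}(prednK d0); lia.
  have -> : (d * v + (d + size P) = d * v.+1 + size P)%N by rewrite mulnS; lia.
  by rewrite exprS; rewrite le_eqVlt; apply/orP; left; apply/eqP; ring.
have B0 : 0 <= B * 2 ^+ (d * v.+1 + size P).-1.
  by rewrite !mulr_ge0 ?exprn_ge0 ?ler0n.
(* If nothing follows the leaf, no tree remains to hold the [v.+1] internal vertices and the term is
   zero. *)
rewrite normrM; case: P IHP @B {eN} B0 => [|p P] IHP B B0.
  by rewrite /forest_poly big_nil coef1 normr0 mulr0.
apply: le_trans (ler_pM _ _ (yY i) (IHP isT)) _ => //.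
by rewrite le_eqVlt; apply/orP; left; apply/eqP; rewrite /B addnS [in RHS]exprS /=; ring.
Qed.

Lemma coef_height_bound m i v :
  `|(height_poly w y m i)`_v| <= Y * (Y ^+ d.-1 * W * 2 ^+ d) ^+ v.
Proof.
have := @coef_forest_bound [:: (m, i)] v isT.
rewrite /forest_poly big_seq1 /= !addn1 /= => /le_trans; apply.
by rewrite le_eqVlt; apply/orP; left; apply/eqP; rewrite !exprMn -!exprM exprS; ring.
Qed.

End CoefBound.

Local Open Scope classical_set_scope.

Section CvgBig.
Variable K : numFieldType.

Lemma cvg_sum_seq (I : Type) (r : seq I) (f : I -> nat -> K) (l : I -> K) :
  (forall i, f i n @[n --> \oo] --> l i) ->
  (\sum_(i <- r) f i n) @[n --> \oo] --> \sum_(i <- r) l i.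
Proof.
move=> fl; elim: r => [|i r IH].
  by under eq_fun do rewrite big_nil; rewrite big_nil; apply: cvg_cst.
by under eq_fun do rewrite big_cons; rewrite big_cons; apply: cvgD.
Qed.

Lemma cvg_prod_seq (I : Type) (r : seq I) (f : I -> nat -> K) (l : I -> K) :
  (forall i, f i n @[n --> \oo] --> l i) ->
  (\prod_(i <- r) f i n) @[n --> \oo] --> \prod_(i <- r) l i.
Proof.
move=> fl; elim: r => [|i r IH].
  by under eq_fun do rewrite big_nil; rewrite big_nil; apply: cvg_cst.
by under eq_fun do rewrite big_cons; rewrite big_cons; apply: cvgM.
Qed.

End CvgBig.

Section Geometric.
Variables (R : realType) (a q : R).
Hypotheses (q0 : 0 <= q) (q1 : q < 1) (a0 : 0 <= a).

Lemma geometric_tail_le m n : (m <= n)%N ->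
  \sum_(m <= k < n) a * q ^+ k <= a * q ^+ m / (1 - q).
Proof.
move=> mn; have p1 : 0 < 1 - q by rewrite subr_gt0.
rewrite ler_pdivlMr // mulr_suml.
rewrite (eq_bigr (fun k => (- a * q ^+ k.+1) - (- a * q ^+ k))); last first.
  by move=> k _; rewrite exprS; ring.
rewrite telescope_sumr //; have := mulr_ge0 a0 (exprn_ge0 n q0); lra.
Qed.

Lemma geometric_tail_cvg0 (c : R) : c * (a * q ^+ m / (1 - q)) @[m --> \oo] --> (0 : R).
Proof.
have -> : (fun m => c * (a * q ^+ m / (1 - q))) = geometric (c * a / (1 - q)) q.
  by apply/funext => m /=; ring.
by apply: cvg_geometric; rewrite ger0_norm.
Qed.

Lemma real_geometric_limit (u : nat -> R) : (forall n, `|u n| <= a * q ^+ n) ->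
  exists l, forall m, `|l - \sum_(k < m) u k| <= a * q ^+ m / (1 - q).
Proof.
move=> ua; have cu : cvgn (series u).
  apply: normed_cvg; apply: (@series_le_cvg _ (fun n => `|u n|) (geometric a q)).
  - by move=> n; apply: normr_ge0.
  - by move=> n /=; rewrite mulr_ge0 ?exprn_ge0.
  - exact: ua.
  - by apply: is_cvg_geometric_series; rewrite ger0_norm.
exists (limn (series u)) => m.
have cl : (fun n => `|series u n - \sum_(k < m) u k|) @ \oo -->
    `|limn (series u) - \sum_(k < m) u k|.
  by apply: cvg_norm; apply: cvgB => //; apply: cvg_cst.
apply: (cvgr_to_le cl).
near=> n; have mn : (m <= n)%N by near: n; exists m.
rewrite /series /= -(big_mkord xpredT u) (big_cat_nat (leq0n m) mn) //= addrAC subrr add0r.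
apply: le_trans (geometric_tail_le mn); apply: le_trans (ler_norm_sum _ _ _) _.
by apply: ler_sum.
Unshelve. all: by end_near. Qed.

End Geometric.

Section ComplexSeries.
Variable R : realType.
Local Notation C := R[i].
Local Notation normc := (@Normc.normc R).

Lemma normrC (z : C) : `|z| = (normc z)%:C%C.
Proof. by case: z => x y; rewrite normc_def. Qed.

Lemma normc_ge0 (z : C) : 0 <= normc z.
Proof. by rewrite -ler0c -normrC. Qed.

Lemma normc_triangle (x y z : C) : normc (x - y) <= normc (x - z) + normc (y - z).
Proof.
rewrite -lecR rmorphD /= -!normrC -(normrN (y - z)) opprB.
by apply: le_trans (ler_normD _ _); rewrite addrA subrK.
Qed.

Lemma normc_sum_le (I : Type) (r : seq I) (P : pred I) (u : I -> C) :
  normc (\sum_(k <- r | P k) u k) <= \sum_(k <- r | P k) normc (u k).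
Proof.
rewrite -lecR rmorph_sum /= -normrC; apply: le_trans (ler_norm_sum _ _ _) _.
by apply: ler_sum => k _; rewrite normrC.
Qed.

(** The norm of [C^o] and its radii [eps] live in [R[i]]; a positive [eps] is real, so it may be
    compared through its real part. *)
Lemma cvg_normc (u : nat -> C^o) (l : C^o) (e : nat -> R) :
  e @ \oo --> (0 : R) -> (forall n, normc (l - u n) <= e n) -> u @ \oo --> l.
Proof.
move=> e0 ue; apply/(@pseudometric_normed_Zmodule.cvgrPdist_lt C C^o) => eps eps0.
have epsE : (eps : C) = (complex.Re (eps : C))%:C%C by rewrite RRe_real // gtr0_real.
have re0 : 0 < complex.Re (eps : C) by move: eps0; rewrite {1}epsE ltcR.
near=> n; have en : e n < complex.Re (eps : C) by near: n; apply: cvgr_lt e0 _ re0.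
by rewrite normrC epsE ltcR; apply: le_lt_trans (ue n) en.
Unshelve. all: by end_near. Qed.

(** Real and imaginary parts converge separately; bounding the modulus by the sum of their absolute
    values costs the factor 2. *)
Lemma complex_geometric_limit (u : nat -> C) (a q : R) : 0 <= q -> q < 1 -> 0 <= a ->
  (forall n, normc (u n) <= a * q ^+ n) ->
  exists l, forall m, normc (l - \sum_(k < m) u k) <= 2 * (a * q ^+ m / (1 - q)).
Proof.
move=> q0 q1 a0 ua.
have re z : `|complex.Re z| <= normc z.
  by rewrite -lecR -normrC; apply: normc_ge_Re.
have im z : `|complex.Im z| <= normc z.
  case: z => x y /=; rewrite -(sqrtr_sqr y) ler_wsqrtr // lerDr sqr_ge0 //.
have [x xP] := real_geometric_limit q0 q1 a0 (fun n => le_trans (re _) (ua n)).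
have [y yP] := real_geometric_limit q0 q1 a0 (fun n => le_trans (im _) (ua n)).
exists (x +i* y)%C => m.
have -> : \sum_(k < m) u k = ((\sum_(k < m) complex.Re (u k)) +i* (\sum_(k < m) complex.Im (u k)))%C.
  elim: m => [|m IH]; first by rewrite !big_ord0.
  by rewrite !big_ord_recr /= IH; case: (u m).
rewrite mulr2n mulrDl mul1r.
apply: le_trans (lerD (xP m) (yP m)).
rewrite /= -[leRHS]ger0_norm ?addr_ge0 // -sqrtr_sqr ler_wsqrtr //.
set s := x - _; set t := y - _.
by rewrite [leRHS]sqrrD !real_normK ?num_real // lerD2r lerDl mulrn_wge0 // mulr_ge0.
Qed.

End ComplexSeries.

(** * The tree series as the limit of the polynomials at 1 *)

Section Limit.
Variables (R : realType) (n d : nat).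
Local Notation C := R[i].
Local Notation normc := (@Normc.normc R).
Variables Y W : R.
Let q : R := Y ^+ d.-1 * W * 2 ^+ d.
Hypotheses (d0 : (0 < d)%N) (Y0 : 0 <= Y) (W0 : 0 <= W) (q1 : q < 1).

Let q0 : 0 <= q. Proof. by rewrite !mulr_ge0 ?exprn_ge0. Qed.

Section Family.
Variable w : 'I_n -> {ffun 'I_d -> 'I_n} -> C.
Variable y : 'I_n -> C.
Hypothesis yY : forall i, normc (y i) <= Y.
Hypothesis wW : forall i, d`!%:R^-1 * \sum_j normc (w i j) <= W.

Lemma normc_height_coef m i v : normc (height_poly w y m i)`_v <= Y * q ^+ v.
Proof.
rewrite -lecR -normrC.
have -> : (Y * q ^+ v)%:C%C = Y%:C%C * (Y%:C%C ^+ d.-1 * W%:C%C * 2 ^+ d) ^+ v :> C.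
  by rewrite /q !(rmorphM, rmorphXn) /= rmorph_nat.
apply: coef_height_bound => // j; first by rewrite normrC lecR.
have -> : d`!%:R^-1 = (d`!%:R^-1)%:C%C :> C by rewrite fmorphV rmorph_nat.
under eq_bigr do rewrite normrC.
by rewrite -rmorph_sum -rmorphM lecR.
Qed.

Hypothesis sw : symmetric_family w.

(** A tree with [v] internal vertices has height at most [v.+1], a single leaf having height 1. *)
Definition tree_coef i v : C := (height_poly w y v.+1 i)`_v.

(** By [tree_sum] both coefficients, multiplied by the same nonzero integer, equal one tree sum. *)
Lemma height_coef_stable m i v : (v < m)%N -> (height_poly w y m i)`_v = tree_coef i v.
Proof.
move=> vm; have vv : (v < v.+1)%N by [].
have := tree_sum y i (d.-1 * v + 1) d0 sw vv.
rewrite (tree_sum y i _ d0 sw vm) eqxx => /mulfI; apply.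
by rewrite pnatr_eq0 -lt0n muln_gt0 !fact_gt0.
Qed.

(** For fixed [V] only [N = (d - 1) V + 1] contributes, so the inner partial sums are eventually
    constant. *)
Lemma tree_series_coef i :
  tree_series w y i = limn (series (tree_coef i : nat -> C^o)).
Proof.
rewrite /tree_series [X in series X](_ : _ = tree_coef i) //; apply/funext => V.
have vV : (V < V.+1)%N by [].
pose N0 := (d.-1 * V + 1)%N.
apply: (@lim_near_cst C^o) => //; near=> N.
have N0N : (N0 < N)%N by near: N; exists N0.+1.
rewrite /series /= (bigD1_seq N0) ?mem_index_iota ?iota_uniq //=.
rewrite (tree_sum y i _ d0 sw vV) eqxx natrM mulKf; last first.
  by rewrite mulf_neq0 // pnatr_eq0 -lt0n fact_gt0.
rewrite big1 ?addr0 // => N' /negPf nN.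
by rewrite (tree_sum y i _ d0 sw vV) -/N0 nN mulr0.
Unshelve. all: by end_near. Qed.

Lemma tree_series_tail i m :
  normc (tree_series w y i - \sum_(k < m) tree_coef i k) <= 2 * (Y * q ^+ m / (1 - q)).
Proof.
have [l lP] := complex_geometric_limit q0 q1 Y0 (fun v => normc_height_coef v.+1 i v).
suff -> : tree_series w y i = l by apply: lP.
rewrite tree_series_coef; apply: (@cvg_lim C^o) => //.
apply: (cvg_normc (geometric_tail_cvg0 Y q0 q1 2)) => k.
by rewrite /series /= big_mkord; apply: lP.
Qed.

(** [tree_series_tail] at [m = 0] would lose a factor 2. Instead, the partial sums are bounded by
    the geometric series and the remainder tends to 0. *)
Lemma tree_series_bound i : normc (tree_series w y i) <= Y / (1 - q).
Proof.
have c : (fun m => Y / (1 - q) + 2 * (Y * q ^+ m / (1 - q))) @ \oo --> Y / (1 - q).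
  rewrite -[X in _ --> X]addr0; apply: cvgD; first exact: cvg_cst.
  exact: geometric_tail_cvg0.
apply: (cvgr_to_ge c); near=> m.
have := normc_triangle (tree_series w y i) 0 (\sum_(k < m) tree_coef i k).
rewrite subr0 sub0r addrC normcN => /le_trans; apply.
apply: lerD (tree_series_tail i m); apply: le_trans (normc_sum_le _ _ _) _.
apply: (@le_trans _ _ (\sum_(0 <= k < m) Y * q ^+ k)).
  by rewrite big_mkord; apply: ler_sum => k _; apply: normc_height_coef.
by apply: le_trans (geometric_tail_le q0 q1 Y0 (leq0n m)) _; rewrite expr0 mulr1.
Unshelve. all: by end_near. Qed.

(** The polynomial at height [m] and the series share their first [m] coefficients. The remainder of
    the series costs 2 geometric tails and that of the polynomial one more, whence the constant
    3. *)
Lemma height_eval_cvg i :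
  ((height_poly w y m i).[1] : C^o) @[m --> \oo] --> (tree_series w y i : C^o).
Proof.
apply: (cvg_normc (geometric_tail_cvg0 Y q0 q1 3)) => m.
set Q := height_poly w y m i; set S := \sum_(k < m) tree_coef i k.
have mM : (m <= maxn m (size Q))%N by apply: leq_maxl.
have QS : Q.[1] - S = \sum_(m <= k < maxn m (size Q)) Q`_k.
  rewrite (@horner_coef_wide _ (maxn m (size Q))) ?leq_maxr //.
  rewrite -(big_mkord xpredT (fun k => Q`_k * 1 ^+ k)) (big_cat_nat (leq0n m) mM) /=.
  have -> : \sum_(0 <= k < m) Q`_k * 1 ^+ k = S.
    rewrite big_mkord; apply: eq_bigr => k _.
    by rewrite expr1n mulr1 height_coef_stable.
  rewrite addrAC subrr add0r; apply: eq_bigr => k _; by rewrite expr1n mulr1.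
apply: le_trans (normc_triangle _ _ S) _.
have := tree_series_tail i m; rewrite -/S => h1.
have h2 : normc (Q.[1] - S) <= Y * q ^+ m / (1 - q).
  rewrite QS; apply: le_trans (normc_sum_le _ _ _) _.
  apply: le_trans (geometric_tail_le q0 q1 Y0 mM).
  by apply: ler_sum => k _; apply: normc_height_coef.
by apply: le_trans (lerD h1 h2) _; rewrite le_eqVlt; apply/orP; left; apply/eqP; ring.
Qed.

Lemma poly_map_tree_series i : poly_map w (tree_series w y) i = y i.
Proof.
have c1 : ((height_poly w y m.+1 i).[1] : C^o) @[m --> \oo] -->
    (y i + d`!%:R^-1 * \sum_j (w i j * \prod_(k < d) tree_series w y (j k)) : C^o).
  have -> : (fun m => (height_poly w y m.+1 i).[1] : C^o) =
    (fun m => y i + d`!%:R^-1 *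
       \sum_j (w i j * \prod_(k < d) (height_poly w y m (j k)).[1])).
    apply/funext => m /=; rewrite !hornerE /=; congr (_ + _ * _).
    by rewrite horner_sum; apply: eq_bigr => j _; rewrite hornerZ horner_prod.
  apply: (@cvgD C C^o); first exact: cvg_cst.
  apply: (@cvgM C); first exact: cvg_cst.
  apply: (@cvg_sum_seq C) => j; apply: (@cvgM C); first exact: cvg_cst.
  apply: (@cvg_prod_seq C) => k; exact: height_eval_cvg.
have c2 : ((height_poly w y m.+1 i).[1] : C^o) @[m --> \oo] --> (tree_series w y i : C^o).
  have := @height_eval_cvg i; rewrite -(cvg_shiftS (fun m => (height_poly w y m i).[1] : C^o)).
  exact.
rewrite /poly_map.
have -> : tree_series w y i = y i + d`!%:R^-1 * \sum_j (w i j * \prod_(k < d) tree_series w y (j k)).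
  exact: (@cvg_unique C^o _ _ _ _ _ c2 c1).
by rewrite addrK.
Qed.

End Family.
End Limit.

(** * Absolute convergence over all trees *)

Section AbsoluteConvergence.
Variables (R : realType) (n d : nat).
Local Notation C := R[i].
Local Notation normc := (@Normc.normc R).
Variables Y W : R.
Let q : R := Y ^+ d.-1 * W * 2 ^+ d.
Hypotheses (d0 : (0 < d)%N) (Y0 : 0 <= Y) (W0 : 0 <= W) (q1 : q < 1).
Variable w : 'I_n -> {ffun 'I_d -> 'I_n} -> C.
Variable y : 'I_n -> C.
Hypothesis yY : forall i, normc (y i) <= Y.
Hypothesis wW : forall i, d`!%:R^-1 * \sum_j normc (w i j) <= W.
Hypothesis sw : symmetric_family w.

Let normw i j : C := (normc (w i j))%:C%C.
Let normy i : C := (normc (y i))%:C%C.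

Let q0 : 0 <= q. Proof. by rewrite !mulr_ge0 ?exprn_ge0. Qed.

Lemma normc_id (z : C) : normc ((normc z)%:C%C) = normc z.
Proof.
apply/eqP; rewrite eq_le -!lecR -(normrC (normc z)%:C%C) -normrC normr_id.
by rewrite lexx.
Qed.

Lemma normc_nat m : normc m%:R = m%:R.
Proof. by apply: complexI; rewrite -normrC normr_nat rmorph_nat. Qed.

Lemma norm_amplitude i V N (T : {set {set vertex V N}}) :
  `|amplitude w y i T| <= amplitude normw normy i T.
Proof.
apply: le_trans (ler_norm_sum _ _ _) _; apply: ler_sum => f _.
rewrite /indexed_amplitude normrM !normr_prod le_eqVlt; apply/orP; left; apply/eqP.
by congr (_ * _); apply: eq_bigr => k _; rewrite normrC.
Qed.

(** Amplitudes are dominated by those of the moduli [normw] and [normy]. This family is again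
    symmetric with the same bounds, so [tree_sum] and the coefficient bound apply to it. *)
Lemma sum_norm_amplitude i V N :
  \sum_(T in admissible_trees d V N) normc (amplitude w y i T) / (V`! * N`!)%:R <=
  if N == (d.-1 * V + 1)%N then Y * q ^+ V else 0.
Proof.
have snw : symmetric_family normw by move=> k s j; rewrite /normw sw.
have ny k : normc (normy k) <= Y by rewrite normc_id.
have nw k : d`!%:R^-1 * \sum_j normc (normw k j) <= W.
  by under eq_bigr do rewrite normc_id.
have c0 : (V`! * N`!)%:R != 0 :> R by rewrite pnatr_eq0 -lt0n muln_gt0 !fact_gt0.
rewrite -mulr_suml ler_pdivrMr ?lt0r ?c0 ?ler0n //.
set S := \sum_(T in _) _.
have S0 : 0 <= S by apply: sumr_ge0 => T _; apply: normc_ge0.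
have : S%:C%C <= \sum_(T in admissible_trees d V N) amplitude normw normy i T.
  by rewrite rmorph_sum /=; apply: ler_sum => T _; rewrite -normrC norm_amplitude.
have vV : (V < V.+1)%N by [].
rewrite (tree_sum normy i N d0 snw vV); case: eqP => _ h; last first.
  by move: h; rewrite lecR mul0r.
have z0 := le_trans (_ : 0 <= S%:C%C) h.
move: h; rewrite -(ger0_norm (z0 _)) ?ler0c // normrC lecR Normc.normcM => /le_trans; apply.
by rewrite normc_nat mulrC ler_wpM2r ?ler0n // normc_height_coef.
Qed.

(** [M] exceeds every [V] and [N] occurring in [s], so the finite family [s] embeds in the full box
    of trees below [M]. *)
Lemma sum_tree_index (f : tree_index d -> R) (s : seq (tree_index d)) :
  (forall t, 0 <= f t) -> uniq s -> exists M,
  \sum_(t <- s) f t <= \sum_(V < M) \sum_(N < M)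
    \sum_(T : {T : {set {set vertex V N}} | T \in admissible_trees d V N})
      f (existT _ (V : nat, N : nat) T).
Proof.
move=> f0 us; pose M := (\max_(t <- s) maxn (tag t).1 (tag t).2).+1; exists M.
pose e V N (T : {T : {set {set vertex V N}} | T \in admissible_trees d V N}) : tree_index d :=
  existT _ (V, N) T.
apply: (@le_trans _ _ (\sum_(t <- s) \sum_(V < M) \sum_(N < M) \sum_T
    (if t == e V N T then f (e V N T) else 0))).
  rewrite big_seq [leRHS]big_seq; apply: ler_sum => t ts.
  have := leq_bigmax_seq t (F := fun t : tree_index d => maxn (tag t).1 (tag t).2) ts isT.
  rewrite -ltnS -/M gtn_max => /andP[].
  case: t {ts} => -[V N] T /= VM NM.
  rewrite (bigD1 (Ordinal VM)) //= (bigD1 (Ordinal NM)) //= (bigD1 T) //= eqxx.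
  rewrite -!addrA lerDl !addr_ge0 //; do ?[apply: sumr_ge0 => ? _]; by case: ifP.
rewrite exchange_big; apply: ler_sum => V _; rewrite exchange_big.
apply: ler_sum => N _; rewrite exchange_big; apply: ler_sum => T _.
rewrite -big_mkcond big_const_seq iter_addr_0 -/(e V N T).
have -> : count (fun i => i == e V N T) s = (e V N T \in s).
  by rewrite -(count_uniq_mem _ us); apply: eq_count => t /=; rewrite eq_sym.
by case: (_ \in s); rewrite ?mulr1n ?mulr0n.
Qed.

Lemma tree_series_absolutely_convergent i : absolutely_convergent w y i.
Proof.
rewrite /absolutely_convergent; apply: (@le_lt_trans _ _ (Y / (1 - q))%:E); last exact: ltry.
(* The sum is the supremum of its finite subsums, each of which is bounded by the geometric series
   in [V]. *)
apply: ge_ereal_sup => _ [A [finA _] <-].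
rewrite fsbig_finite //= sumEFin lee_fin.
have [||M /le_trans ->//] := @sum_tree_index
  (fun t => normc (tree_term w y i t)) (finmap.enum_fset (fset_set A)).
- by move=> t; apply: normc_ge0.
- exact: finmap.fset_uniq.
apply: (@le_trans _ _ (\sum_(V < M) Y * q ^+ V)); last first.
  rewrite -(big_mkord xpredT (fun V => Y * q ^+ V)).
  by apply: le_trans (geometric_tail_le q0 q1 Y0 (leq0n M)) _; rewrite expr0 mulr1.
apply: ler_sum => V _.
apply: (@le_trans _ _ (\sum_(N < M) if N == (d.-1 * V + 1)%N :> nat then Y * q ^+ V else 0)).
  apply: ler_sum => N _; apply: le_trans (sum_norm_amplitude i V N).
  by rewrite [leRHS]big_sub /= le_eqVlt; apply/orP; left; apply/eqP/eq_bigr => T _;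
    rewrite /tree_term Normc.normcM Normc.normcV normc_nat.
case: (ltnP (d.-1 * V + 1) M) => [h|h]; last first.
  rewrite big1 ?mulr_ge0 ?exprn_ge0 // => N _; case: eqP => // NV.
  by have := ltn_ord N; rewrite NV ltnNge h.
rewrite (bigD1 (Ordinal h)) //= eqxx big1 ?addr0 // => N /negPf nN.
by rewrite -val_eqE /= in nN; rewrite nN.
Qed.

End AbsoluteConvergence.

(** * From the radius of inversion to the geometric ratio *)

Section Radius.
Variables (R : realType) (n d : nat).
Local Notation normc := (@Normc.normc R).
Variable w : 'I_n -> {ffun 'I_d -> 'I_n} -> R[i].

Lemma le_norm_inf1 i : \sum_j normc (w i j) <= norm_inf1 w.
Proof. exact: (le_bigmax (0 : R) (fun i => \sum_j normc (w i j))). Qed.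

Lemma norm_inf1_ge0 : 0 <= norm_inf1 w.
Proof. exact: bigmax_ge_id. Qed.

Lemma norm_inf1_eq0 : (norm_inf1 w == 0) = [forall i, forall j, w i j == 0].
Proof.
apply/eqP/'forall_forallP => [w0 i j|w0].
  apply/eqP/Normc.eq0_normc/eqP; rewrite eq_le normc_ge0 andbT.
  rewrite -w0; apply: le_trans (le_norm_inf1 i).
  by rewrite (bigD1 j) //= lerDl sumr_ge0 // => k _; apply: normc_ge0.
rewrite /norm_inf1 big1_idem //= ?maxxx // => i _; apply: big1 => j _.
by rewrite (eqP (w0 i j)) Normc.normc0.
Qed.

(* With t = Y / R one has q = t ^ (d - 1) <= t. *)
Lemma radius_ratio (Y : R) : (2 <= d)%N -> 0 <= Y ->
  (Y%:E < inversion_radius w)%E -> exists2 q, 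
    q = Y ^+ d.-1 * (norm_inf1 w / d`!%:R) * 2 ^+ d & q < 1 /\
    ((Y / (1 - q))%:E <= Y%:E / (1 - Y%:E / inversion_radius w))%E.
Proof.
move=> d2 Y0; rewrite /inversion_radius -norm_inf1_eq0; have [w0|w0] := eqVneq.
  (* For [w = 0] the radius is infinite, [Y / R] is 0 and the ratio is 0. *)
  move=> _; exists 0; first by rewrite w0 mul0r mulr0 mul0r.
  by split=> //; rewrite invey mule0 sube0 inve1 mule1 subr0 divr1.
set W := norm_inf1 w in w0 *.
have W0 : 0 < W by rewrite lt0r w0 norm_inf1_ge0.
have f0 : 0 < d`!%:R :> R by rewrite ltr0n fact_gt0.
have p0 : 0 < 2 ^+ d :> R by rewrite exprn_gt0.
set b := d`!%:R / (2 ^+ d * W); have b0 : 0 < b by rewrite divr_gt0 ?mulr_gt0.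
set r := b `^ _; have r0 : 0 < r by apply: powR_gt0.
have d1 : (0 < d.-1)%N by rewrite -ltnS prednK // (ltn_trans _ d2).
have rd : r ^+ d.-1 = b.
  rewrite -powR_mulrn ?ltW // -powRrM mulVf ?powRr1 ?ltW //.
  by rewrite pnatr_eq0 -lt0n.
rewrite lte_fin => Yr; pose t := Y / r.
have t0 : 0 <= t by rewrite divr_ge0 // ltW.
have t1 : t < 1 by rewrite ltr_pdivrMr ?mul1r.
exists (t ^+ d.-1).
  rewrite expr_div_n rd /b; field.
  by rewrite !lt0r_neq0.
have qt : t ^+ d.-1 <= t.
  by rewrite -{2}[t]expr1; apply: ler_wiXn2l => //; apply: ltW.
split; first exact: le_lt_trans qt t1.
rewrite inver gt_eqF // -EFinM -/t -EFinB inver gt_eqF ?subr_gt0 //.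
rewrite -EFinM lee_fin ler_wpM2l // lef_pV2 ?posrE ?subr_gt0 //.
  by rewrite lerD2l lerN2.
exact: le_lt_trans qt t1.
Qed.

End Radius.

Theorem theorem1 (R : realType) (n d : nat)
    (w : 'I_n -> {ffun 'I_d -> 'I_n} -> R[i])
    (hn : (1 <= n)%N) (hd : (2 <= d)%N) (hw : symmetric_family w)
    (y : 'I_n -> R[i]) (hy : ((sup_norm y)%:E < inversion_radius w)%E) :
  (forall i : 'I_n, absolutely_convergent w y i) /\
  ((sup_norm (tree_series w y))%:E
     <= (sup_norm y)%:E / (1 - (sup_norm y)%:E / inversion_radius w))%E /\
  poly_map w (tree_series w y) = y.
Proof.
have Y0 : 0 <= sup_norm y by apply: bigmax_ge_id.
have [q qE [q1 leq]] := radius_ratio hd Y0 hy.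
rewrite {}qE in q1 leq.
have d0 : (0 < d)%N by apply: ltnW.
have yY i : Normc.normc (y i) <= sup_norm y by apply: le_bigmax.
(* The analytic results are applied with [Y] the norm of [y] and [W] the norm of [w] divided by
   [d!]. *)
have W0 : 0 <= norm_inf1 w / d`!%:R by rewrite divr_ge0 ?ler0n ?norm_inf1_ge0.
have wW i : d`!%:R^-1 * \sum_j Normc.normc (w i j) <= norm_inf1 w / d`!%:R.
  by rewrite mulrC ler_wpM2r ?invr_ge0 ?ler0n ?le_norm_inf1.
split; [|split].
- by move=> i; apply: (tree_series_absolutely_convergent d0 Y0 W0 q1 yY wW hw).
- apply: le_trans leq; rewrite lee_fin; apply: bigmax_le => [|i _].
    by rewrite divr_ge0 // subr_ge0 ltW.
  exact: (tree_series_bound d0 Y0 W0 q1 yY wW hw).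
- by apply/funext => i; apply: (poly_map_tree_series d0 Y0 W0 q1 yY wW hw).
Qed.
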